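(* Let $f\colon S\to S$ be the homeomorphism of the genus two surface $S$ obtained, by the gluing construction described in the context, from two diffeomorphisms $f_1\colon S_1\to S_1$ and $f_2\colon S_2\to S_2$ of two disjoint copies $S_1,S_2$ of the torus $\mathbb{R}^2/\mathbb{Z}^2$. Then $f$ is $2$-expansive but it is not expansive.
   Context: For a homeomorphism $f\colon X\to X$ of a compact metric space $(X,d)$, $x\in X$ and $\epsilon>0$, put $\Gamma_\epsilon(x)=\{y\in X: d(f^n(x),f^n(y))\le \epsilon \text{ for all } n\in\mathbb{Z}\}$. $f$ is $n$-expansive if there is $\alpha>0$ such that $\Gamma_\alpha(x)$ has at most $n$ elements for every $x\in X$; $f$ is expansive if it is $1$-expansive. Construction. Let $S_1$, $S_2$ be two disjoint copies of the torus $\mathbb{R}^2/\mathbb{Z}^2$ and $f_i\colon S_i\to S_i$ diffeomorphisms such that: $f_1$ is a derived-from-Anosov diffeomorphism (that is, the standard DA-diffeomorphism obtained by modifying a hyperbolic toral automorphism near a fixed point along its stable foliation, so that the stable foliation of the automorphism is still $f_1$-invariant and is called the stable foliation of $f_1$, and the nonwandering set of $f_1$ is the union of a fixed source $p_1$ and a one-dimensional hyperbolic attractor); $f_2$ is conjugate to $f_1^{-1}$ (its unstable foliation corresponding to the stable foliation of $f_1$); and $f_2$ has a fixed sink $p_2$ (corresponding to the source $p_1$). Let $D=\{x\in\mathbb{R}^2:\|x\|\le 2\}$ and assume there are local charts $\varphi_i\colon D\to S_i$, $i=1,2$, such that: (1) $\varphi_i(0)=p_i$; (2) the pull-back by $\varphi_1$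 of the stable foliation of $f_1$ is the vertical foliation of $D$ and the pull-back by $\varphi_2$ of the unstable foliation of $f_2$ is the horizontal foliation of $D$; (3) $\varphi_1^{-1}\circ f_1^{-1}\circ\varphi_1(x)=\varphi_2^{-1}\circ f_2\circ\varphi_2(x)=x/4$ for all $x\in D$. Let $A=\{x\in\mathbb{R}^2:1/2\le\|x\|\le 2\}$, $\hat D=\{x\in\mathbb{R}^2:\|x\|<1/2\}$ and let $\psi(x)=x/\|x\|^2$. On $[S_1\setminus\varphi_1(\hat D)]\cup[S_2\setminus\varphi_2(\hat D)]$ consider the equivalence relation generated by $\varphi_1(x)\sim\varphi_2\circ\psi(x)$ for all $x\in A$, and let $\overline{x}$ denote the class of $x$. Let $S$ be the quotient space, a genus two surface (bitorus) with the quotient topology. Define $f\colon S\to S$ by $f(\overline{x})=\overline{f_1(x)}$ if $x\in S_1\setminus\varphi_1(\hat D)$ and $f(\overline{x})=\overline{f_2(x)}$ if $x\in S_2\setminus\varphi_2(D)$. This is a homeomorphism of $S$. $S$ is equipped with any metric compatible with its topology. *)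

(* Defs.v *)
From HB Require Import structures.
From Stdlib Require Import Relation_Operators.
From mathcomp Require Import all_boot all_order all_algebra.
From mathcomp Require Import all_classical all_reals all_analysis.
From mathcomp Require Import generic_quotient complex.

Set Implicit Arguments.
Unset Strict Implicit.
Unset Printing Implicit Defensive.

Import Order.TTheory GRing.Theory Num.Theory.
Import numFieldNormedType.Exports.

Local Open Scope classical_set_scope.
Local Open Scope ring_scope.
Local Open Scope quotient_scope.

(** ** Homeomorphisms, expansivity *)

Record homeo (X Y : topologicalType) := Homeo {
  fwd :> X -> Y;
  bwd : Y -> X;
  fwdK : cancel fwd bwd;
  bwdK : cancel bwd fwd;
  fwd_continuous : continuous fwd;
  bwd_continuous : continuous bwd }.

Definition iterz (X : topologicalType) (f : homeo X X) (n : int) : X -> X :=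
  match n with
  | Posz k => iter k (fwd f)
  | Negz k => iter k.+1 (bwd f)
  end.

Section Expansivity.
Variables (R : realType) (X : topologicalType).
Implicit Types (d : X -> X -> R) (f : homeo X X).

Definition is_metric d :=
  [/\ forall x y, 0 <= d x y,
      forall x y, d x y = 0 <-> x = y,
      forall x y, d x y = d y x &
      forall x y z, d x z <= d x y + d y z].

Definition compatible_metric d :=
  is_metric d /\
  forall (x : X) (U : set X),
    nbhs x U <-> exists2 e : R, 0 < e & [set y | d x y < e] `<=` U.

Definition dyn_ball d f (e : R) (x : X) : set X :=
  [set y | forall n : int, d (iterz f n x) (iterz f n y) <= e].

Definition n_expansive d f (n : nat) :=
  exists2 a : R, 0 < a & forall x, (dyn_ball d f a x #<= `I_n)%card.

Definition expansive d f := n_expansive d f 1.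

Definition nonwandering f : set X :=
  [set x | forall U : set X, open U -> U x ->
    exists n, (iter n.+1 f @` U) `&` U !=set0].

(* An attracting set carrying a dense forward orbit. *)
Definition attractor f (L : set X) :=
  (exists U : set X, [/\ open U, L `<=` U, f @` closure U `<=` U &
     L = \bigcap_n (iter n f @` U)]) /\
  (exists2 x, L x & L `<=` closure [set iter n f x | n in [set: nat]]).

(* Lebesgue covering dimension of K at most n; the elements of the covers
   are traces on K of open sets of X. *)
Definition covering_dim_le (K : set X) (n : nat) :=
  forall (k : nat) (U : 'I_k -> set X),
    (forall i, open (U i)) -> K `<=` \bigcup_i U i ->
  exists (m : nat) (V : 'I_m -> set X),
    [/\ forall j, open (V j),
        K `<=` \bigcup_j V j,
        forall j, exists i, V j `&` K `<=` U i &
        forall x, K x -> (#|[pred j | `[< V j x >]]| <= n.+1)%N].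

Definition one_dimensional (K : set X) :=
  covering_dim_le K 1 /\ ~ covering_dim_le K 0.

End Expansivity.

(** ** The plane and the torus *)

Section Torus.
Variable R : realType.
Local Notation plane := 'rV[R]_2.

Definition enorm (v : plane) : R := Num.sqrt (\sum_j v 0 j ^+ 2).

Definition lattice_rel : rel plane := fun v w => v - w \is a mxOver Num.int.

Lemma lattice_equiv_class : equiv_class_of lattice_rel.
Proof.
split=> [v|v w|w v u]; rewrite /lattice_rel.
- by apply/mxOverP => i j; rewrite subrr mxE rpred0.
- by apply/mxOverP/mxOverP => H i j; rewrite -opprB mxE rpredN; exact: H.
- move=> /mxOverP vw /mxOverP wu; apply/mxOverP => i j.
  by rewrite -(subrKA w) mxE rpredD.
Qed.

Definition lattice_equiv : equiv_rel plane := EquivRelPack lattice_equiv_class.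

Definition torus : Type := quotient_topology {eq_quot lattice_equiv}.
HB.instance Definition _ := Topological.on torus.
HB.instance Definition _ := Quotient.on torus.

Definition tproj (v : plane) : torus := \pi_torus v.

(* F and G are mutually inverse C^1 lifts of f and its inverse to the plane.
   Row-vector convention: the derivative acts by w |-> w *m 'J F v. *)
Definition C1_map (F : plane -> plane) :=
  (forall v, differentiable F v) /\
  continuous (fun v => 'J F v : 'M[R]_(2, 2)).

Definition diffeo_lift (f : homeo torus torus) (F G : plane -> plane) :=
  [/\ forall v, tproj (F v) = f (tproj v),
      cancel F G, cancel G F, C1_map F & C1_map G].

Definition diffeomorphism (f : homeo torus torus) :=
  exists F G, diffeo_lift f F G.

Definition all_eigenvalues (M : 'M[R]_2) (P : R -> Prop) :=
  forall z : R[i], root (char_poly (map_mx (real_complex R) M)) z ->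
    P (complex.Re `|z|).

(* For a diffeomorphism f any two C^1 lifts differ by a lattice vector, so the
   next three notions do not depend on the lifts. *)
Definition fixed_source (f : homeo torus torus) (p : torus) :=
  f p = p /\ exists F G, diffeo_lift f F G /\
  forall v, tproj v = p -> all_eigenvalues ('J F v) (fun r => 1 < r).

Definition fixed_sink (f : homeo torus torus) (p : torus) :=
  f p = p /\ exists F G, diffeo_lift f F G /\
  forall v, tproj v = p -> all_eigenvalues ('J F v) (fun r => r < 1).

(* Es x and Eu x are the row spaces of the given matrices. *)
Definition hyperbolic_set (f : homeo torus torus) (L : set torus) :=
  [/\ compact L, f @` L = L &
  exists F G, diffeo_lift f F G /\
  exists (Es Eu : torus -> 'M[R]_2) (C lam : R),
    [/\ 0 < C, 0 < lam < 1 &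
    forall v, L (tproj v) ->
    [/\ ((Es (tproj v) + Eu (tproj v))%MS :=: 1%:M)%MS /\
        (Es (tproj v) :&: Eu (tproj v) :=: (0 : 'M[R]_2))%MS,
        (Es (tproj v) *m 'J F v :=: Es (f (tproj v)))%MS,
        (Eu (tproj v) *m 'J F v :=: Eu (f (tproj v)))%MS,
        forall (w : plane) n, (w <= Es (tproj v))%MS ->
          enorm (w *m 'J (iter n F) v) <= C * lam ^+ n * enorm w &
        forall (w : plane) n, (w <= Eu (tproj v))%MS ->
          enorm (w *m 'J (iter n G) v) <= C * lam ^+ n * enorm w]]].

(** ** Derived-from-Anosov diffeomorphisms *)

(* The toral automorphism induced by v |-> v *m A. *)
Definition plane_act (A : 'M[int]_2) (v : plane) : plane :=
  v *m map_mx intr A.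

Definition hyperbolic_automorphism (A : 'M[int]_2) :=
  A \in unitmx /\ all_eigenvalues (map_mx intr A) (fun r => r != 1).

Definition stable_space (A : 'M[int]_2) : set plane :=
  [set w | iter n (plane_act A) w @[n --> \oo] --> (0 : plane)].

(* Leaf through x of the stable foliation of the automorphism. *)
Definition stable_leaf (A : 'M[int]_2) (x : torus) : set torus :=
  [set y | exists v w, [/\ tproj v = x, stable_space A w & y = tproj (v + w)]].

(* f is the automorphism A followed by a modification which is supported in an
   embedded round disc about the fixed point p and moves points along stable
   leaves; in particular f maps leaves of the stable foliation of A to leaves.
   For the classical flow construction the modification is the time-tau map of
   the flow. *)
Definition derived_from_anosov
    (A : 'M[int]_2) (f : homeo torus torus) (p : torus) :=
  [/\ hyperbolic_automorphism A,
      exists F G (q : plane) (r : R),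
        [/\ diffeo_lift f F G,
            tproj q = p /\ tproj (plane_act A q) = p,
            forall v, stable_space A (F v - plane_act A v),
            0 < r < 2^-1 &
            forall v, (forall q', tproj q' = p ->
                         r <= enorm (plane_act A v - q')) ->
              F v = plane_act A v],
      fixed_source f p &
      exists L : set torus,
        [/\ nonwandering f = p |` L, hyperbolic_set f L, attractor f L &
            one_dimensional L]].

(** ** Charts and gluing *)

Definition disc : set plane := [set v | enorm v <= 2].
Definition open_disc : set plane := [set v | enorm v < 2].
Definition hole : set plane := [set v | enorm v < 2^-1].
Definition annulus : set plane := [set v | 2^-1 <= enorm v <= 2].
Definition inversion (v : plane) : plane := (enorm v ^+ 2)^-1 *: v.

(* Topological charts: a continuous injection of the compact set disc into the
   torus is an embedding. Charts are not required to be C^1: since f is affine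
   transversally to the stable foliation with multiplier an eigenvalue of A,
   which is irrational, no C^1 chart conjugates f to x |-> 4 x. *)
Definition local_chart (phi : plane -> torus) :=
  [/\ {within disc, continuous phi}, {in disc &, injective phi} &
      open (phi @` open_disc)].

(* The leaves of the foliation of disc pulled back by phi are the connected
   components of the preimages of the leaves. *)
Definition pullback_leaf (phi : plane -> torus) (leaf : torus -> set torus)
    (v : plane) : set plane :=
  connected_component (disc `&` phi @^-1` leaf (phi v)) v.

Definition pullback_vertical (phi : plane -> torus)
    (leaf : torus -> set torus) :=
  forall v, disc v ->
    pullback_leaf phi leaf v = disc `&` [set w | w 0 0 = v 0 0].

Definition pullback_horizontal (phi : plane -> torus)
    (leaf : torus -> set torus) :=
  forall v, disc v ->
    pullback_leaf phi leaf v = disc `&` [set w | w 0 1 = v 0 1].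

Section Gluing.
Variables phi1 phi2 : plane -> torus.

(* S_1 is the copy indexed by false and S_2 the copy indexed by true. *)
Definition punctured : set (bool * torus) :=
  [set x | ~ ((if x.1 then phi2 else phi1) @` hole) x.2].

Definition glue_rel (x y : set_type punctured) : Prop :=
  exists v, [/\ annulus v, val x = (false, phi1 v) &
                val y = (true, phi2 (inversion v))].

Definition glue_eqv : rel (set_type punctured) :=
  fun x y => `[< clos_refl_sym_trans _ glue_rel x y >].

Lemma glue_equiv_class : equiv_class_of glue_eqv.
Proof.
split=> [x|x y|y x z].
- by apply/asboolP; exact: rst_refl.
- by apply/idP/idP => /asboolP xy; apply/asboolP; exact: rst_sym.
- by move=> /asboolP xy /asboolP yz; apply/asboolP; exact: rst_trans xy yz.
Qed.

Definition glue_equiv : equiv_rel (set_type punctured) :=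
  EquivRelPack glue_equiv_class.

Definition bitorus : Type := quotient_topology {eq_quot glue_equiv}.
HB.instance Definition _ := Topological.on bitorus.
HB.instance Definition _ := Quotient.on bitorus.

Definition bclass (x : set_type punctured) : bitorus := \pi_bitorus x.

(* By the linearity of f1 and f2 in the charts, f1 a and f2 a below lie again
   outside the holes, and the two clauses determine f. *)
Definition glued_map (f1 f2 : torus -> torus) (f : bitorus -> bitorus) :=
  (forall x a, val x = (false, a) ->
     exists2 y, val y = (false, f1 a) & f (bclass x) = bclass y) /\
  (forall x a, val x = (true, a) -> ~ (phi2 @` disc) a ->
     exists2 y, val y = (true, f2 a) & f (bclass x) = bclass y).

End Gluing.
End Torus.

(* Main.v *)
(** The key point is a tangency. In the chart annulus the local stable sets of
    the glued map are vertical segments and the local unstable sets are images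
    under the inversion of horizontal segments, that is, arcs of circles tangent
    to the horizontal axis at the origin. A vertical line meets such a circle in
    at most two points, which bounds dynamical balls by two, and the two points
    (1, t) and (1, 1/t), which lie on a common circle, get arbitrarily close as
    t tends to 1, which excludes expansivity.

    Conjugating the second torus by h turns f2 into the inverse of f1, so both
    halves are instances of one statement about f1 with a chart at the source p1.
    The transverse component of a displacement (the coordinate of the unstable
    eigendirection of A) is multiplied by the unstable eigenvalue under the lift
    F of f1, so that orbits staying close forward differ by a short vector of the
    stable line. Conversely F contracts stable lines near the attractor L: this
    follows from hyperbolicity along a dense orbit of L, the alternative, that
    the stable direction is expanded on L, being excluded because L would
    contain whole stable lines. Every orbit of f1 that never enters the basin
    of the source backwards lies in L. *)
Require Import Defs.
From Stdlib Require Import Relation_Operators.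
From mathcomp Require Import all_boot all_order all_algebra.
From mathcomp Require Import all_classical all_reals all_analysis.
From mathcomp Require Import complex ring lra.

Import Order.TTheory GRing.Theory Num.Theory numFieldNormedType.Exports.
Local Open Scope classical_set_scope.
Local Open Scope ring_scope.

Set Implicit Arguments.
Unset Strict Implicit.
Unset Printing Implicit Defensive.

(** * Linear algebra of the hyperbolic automorphism *)

(** The metric of the surface is arbitrary and the charts are only continuous, so no estimate can be
    made in either. Everything quantitative happens on lifts to the plane: compactness turns
    closeness in the surface into closeness of lifts, and there the transverse component obeys an
    exact linear law. The annulus is a fundamental domain near the source, since its radii 1/2 and 2
    differ by the factor 4 of the charts. An orbit that meets the annulus is moved there and its
    companions are counted there; these may leave the annulus, but by one step at most, which is why
    radii up to 8 occur. An orbit that misses the annulus remains in one torus, where expansivity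
    holds. The two tori play the same role with time reversed, so a statement about one half is
    applied twice, the second time with the inverse of the glued map. *)

Lemma rV2P (R : realType) (v w : 'rV[R]_2) :
  v 0 0 = w 0 0 -> v 0 1 = w 0 1 -> v = w.
Proof.
move=> h0 h1; apply/rowP => i.
by have [->|->] : i = 0 \/ i = 1
  by case: i => [[|[|//]] ?]; [left|right]; exact/val_inj.
Qed.

Lemma coord_le_norm (R : realType) (w : 'rV[R]_2) j : `|w 0 j| <= `|w|.
Proof.
rewrite [leRHS]mx_normrE.
exact: (le_bigmax _ (fun ij : 'I_1 * 'I_2 => `|w ij.1 ij.2|) (0, j)).
Qed.

Lemma norm_le_coord (R : realType) (w : 'rV[R]_2) (c : R) :
  0 <= c -> (forall j, `|w 0 j| <= c) -> `|w| <= c.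
Proof.
move=> c0 wc; rewrite [leLHS]mx_normrE; apply: bigmax_le => // -[i j] _ /=.
by rewrite ord1.
Qed.

Lemma geometric_small (R : realType) (q B eps : R) :
  `|q| < 1 -> 0 < eps -> exists n, `|q| ^+ n * B < eps.
Proof.
move=> q1 e0.
have cv : `|q| ^+ n * B @[n --> \oo] --> (0 : R).
  by rewrite -[X in _ --> X](mul0r B); apply: cvgMl; apply: cvg_expr; rewrite normr_id.
have [N _ NB] := cvgr_lt _ cv _ e0.
by exists N; exact: NB (leqnn N).
Qed.

Lemma expansion_bounded (R : realType) (lam c B : R) :
  1 < `|lam| -> (forall n, `|lam ^+ n * c| <= B) -> c = 0.
Proof.
move=> lam1 cB; apply/eqP; rewrite -normr_le0 leNgt; apply/negP => c0.
have lam0 : 0 < `|lam| by exact: lt_trans lam1.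
have [n] : exists n, `|lam^-1| ^+ n * B < `|c|.
  by apply: geometric_small => //; rewrite normfV invf_lt1.
rewrite ltNge => /negP; apply.
rewrite normfV exprVn mulrC ler_pdivlMr ?exprn_gt0// mulrC -normrX -normrM.
exact: cB.
Qed.

Section LinearAlgebra.
Variable R : realType.
Local Notation plane := 'rV[R]_2.

Lemma char_poly2 (F : comNzRingType) (M : 'M[F]_2) :
  char_poly M = 'X^2 - (\tr M) *: 'X + (\det M)%:P.
Proof.
apply/polyP => i.
have sz := size_char_poly M; have mn := monicP (char_poly_monic M).
rewrite coefD coefB coefXn coefZ coefX coefC.
case: i => [|[|[|i]]] /=.
- by rewrite char_poly_det sqrrN expr1n mul1r mulr0 subr0 add0r.
- by rewrite (@char_poly_trace _ 2) // mulr1 addr0 add0r.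
- by rewrite mulr0 subr0 addr0 -mn lead_coefE sz.
- by rewrite mulr0 subr0 addr0 nth_default // sz.
Qed.

Lemma root_char_poly2 (F : comNzRingType) (M : 'M[F]_2) x :
  root (char_poly M) x = (x ^+ 2 - \tr M * x + \det M == 0).
Proof. by rewrite char_poly2 /root !hornerE. Qed.

(** The determinant is a unit of the integers, so the eigenvalues multiply to 1 in modulus. A
    non-real pair would be conjugate, hence of modulus 1, against hyperbolicity; so both are real
    and lie on either side of the unit circle. *)
Lemma hyperbolic_eigenvalues (A : 'M[int]_2) :
  hyperbolic_automorphism R A ->
  exists kap lam : R, [/\ `|kap| < 1, 1 < `|lam|,
    eigenvalue (map_mx intr A : 'M[R]_2) kap &
    eigenvalue (map_mx intr A : 'M[R]_2) lam].
Proof.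
move=> [Aunit hyp].
set M : 'M[R]_2 := map_mx intr A in hyp *.
set T := \tr M; set D := \det M.
have D1 : `|D| = 1.
  have Du : \det A \is a GRing.unit by rewrite -unitmxE.
  have /(congr1 absz)/eqP := divrr Du.
  rewrite abszM muln_eq1 => /andP[/eqP dA _].
  by rewrite /D /M det_map_mx -intr_norm -abszE dA.
have rootC (x y : R) : (x ^+ 2 - y ^+ 2 - T * x + D = 0) ->
    (2 * x * y - T * y = 0) -> Num.sqrt (x ^+ 2 + y ^+ 2) != 1.
  move=> re im; have := hyp (x +i* y)%C.
  rewrite normc_def /=; apply.
  rewrite root_char_poly2 trace_map_mx det_map_mx -/T -/D.
  apply/eqP; rewrite expr2; simpc.
  apply/eqP; rewrite eq_complex /=; apply/andP; split; apply/eqP.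
    by rewrite -re; ring.
  by rewrite -im; ring.
have eigR (x : R) : x ^+ 2 - T * x + D = 0 -> eigenvalue M x /\ `|x| != 1.
  move=> e; split; first by rewrite eigenvalue_root_char root_char_poly2 e.
  have := rootC x 0; rewrite expr0n /= addr0 sqrtr_sqr; apply; last by ring.
  by rewrite -e; ring.
have [disc|disc] := leP 0 (T ^+ 2 - 4 * D); last first.
  have D0 : D = 1.
    have [/ger0_norm <-//|Dlt] := leP 0 D.
    have := sqr_ge0 T; nra.
  pose y := Num.sqrt (4 * D - T ^+ 2) / 2.
  have yE : y ^+ 2 = D - T ^+ 2 / 4.
    rewrite /y expr_div_n sqr_sqrtr; last by lra.
    by field.
  have := rootC (T / 2) y.
  rewrite yE (_ : (T / 2) ^+ 2 + (D - T ^+ 2 / 4) = 1); last by rewrite D0; field.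
  by rewrite sqrtr1 eqxx => /(_ ltac:(by field) ltac:(by field)).
set s := Num.sqrt (T ^+ 2 - 4 * D).
have sE : s ^+ 2 = T ^+ 2 - 4 * D by rewrite sqr_sqrtr.
have [ep np] := eigR ((T + s) / 2) ltac:(by rewrite expr_div_n sqrrD sE; field).
have [em nm] := eigR ((T - s) / 2) ltac:(by rewrite expr_div_n sqrrB sE; field).
have prod : `|(T + s) / 2| * `|(T - s) / 2| = 1.
  rewrite -normrM -[RHS]D1; congr `|_|.
  transitivity ((T ^+ 2 - s ^+ 2) / 4); first by field.
  by rewrite sE; field.
have [lt1|gt1|] := ltgtP `|(T + s) / 2| 1; last by move/eqP: np.
  exists ((T + s) / 2), ((T - s) / 2); split=> //.
  have := normr_ge0 ((T - s) / 2); nra.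
exists ((T - s) / 2), ((T + s) / 2); split=> //.
have := normr_ge0 ((T - s) / 2); nra.
Qed.

(** [e] is a row eigenvector for the contracting eigenvalue, [r] a column eigenvector for the
    expanding one. Pairing with [r] kills [e] because the eigenvalues differ, and it is multiplied
    by [lam] at each step, so it vanishes on vectors whose iterates stay bounded. *)
Lemma stable_splitting (A : 'M[int]_2) : hyperbolic_automorphism R A ->
  exists (e : plane) (r : 'cV[R]_2) (kap lam : R),
  [/\ e != 0, plane_act A e = kap *: e,
      map_mx intr A *m r = lam *: r, `|kap| < 1 & 1 < `|lam|] /\
  (forall w, (w *m r) 0 0 = 0 -> exists t, w = t *: e) /\
  (forall w, stable_space A w <-> (w *m r) 0 0 = 0).
Proof.
move=> /hyperbolic_eigenvalues[kap [lam [kap1 lam1 ek el]]].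
set M : 'M[R]_2 := map_mx intr A in ek el *.
have [e eE e0] := eigenvalueP ek.
have : eigenvalue M^T lam.
  by move: el; rewrite !eigenvalue_root_char /char_poly -det_tr /char_poly_mx
    linearB /= tr_scalar_mx map_trmx.
move=> /eigenvalueP[rt rE r0].
pose r := rt^T.
have {}rE : M *m r = lam *: r.
  by rewrite -[LHS]trmxK trmx_mul trmxK rE linearZ.
have er : (e *m r) 0 0 = 0.
  have := congr1 (fun X => (X *m r) 0 0) eE.
  rewrite -mulmxA rE -scalemxAl -scalemxAr !mxE => /eqP.
  rewrite -subr_eq0 -mulrBl mulf_eq0 => /orP[|/eqP//].
  rewrite subr_eq0 => /eqP lk; rewrite lk in lam1.
  by have := lt_trans kap1 lam1; rewrite ltxx.
have mulE (w : plane) : (w *m r) 0 0 = w 0 0 * rt 0 0 + w 0 1 * rt 0 1.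
  by rewrite mxE big_ord_recl big_ord1 !mxE; congr (_ + w 0 _ * rt 0 _); exact/val_inj.
have nz (w : plane) : w != 0 -> (w 0 0 != 0) || (w 0 1 != 0).
  apply: contraR; rewrite negb_or !negbK => /andP[/eqP w0 /eqP w1].
  by apply/eqP/rV2P; rewrite ?w0 ?w1 mxE.
have ker w : (w *m r) 0 0 = 0 -> exists t, w = t *: e.
  move: er; rewrite !mulE => er wr.
  have det0 : w 0 0 * e 0 1 = w 0 1 * e 0 0.
    have [r00|r01] := orP (nz _ r0).
      apply: (mulIf r00).
      have {}wr : w 0 0 * rt 0 0 = - (w 0 1 * rt 0 1) by rewrite -sub0r -wr; ring.
      have {}er : e 0 0 * rt 0 0 = - (e 0 1 * rt 0 1) by rewrite -sub0r -er; ring.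
      by rewrite mulrAC wr -mulrA er; ring.
    apply: (mulIf r01).
    have {}wr : w 0 1 * rt 0 1 = - (w 0 0 * rt 0 0) by rewrite -sub0r -wr; ring.
    have {}er : e 0 1 * rt 0 1 = - (e 0 0 * rt 0 0) by rewrite -sub0r -er; ring.
    by rewrite -mulrA er [RHS]mulrAC wr; ring.
  have [e00|e01] := orP (nz _ e0).
    exists (w 0 0 / e 0 0); apply: rV2P; rewrite mxE ?divfK //.
    by rewrite mulrAC det0 mulfK.
  exists (w 0 1 / e 0 1); apply: rV2P; rewrite mxE ?divfK //.
  by rewrite mulrAC -det0 mulfK.
exists e, r, kap, lam; split; [by split|split=> // w].
rewrite /stable_space /=; split=> [cv|/ker[t ->]]; last first.
  have it n : iter n (plane_act A) (t *: e) = kap ^+ n *: (t *: e).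
    elim: n => [|n IH]; first by rewrite expr0 scale1r.
    by rewrite iterS IH /plane_act -!scalemxAl eE !scalerA exprSr; congr (_ *: _); ring.
  rewrite (_ : (fun n => _) = (fun n => kap ^+ n *: (t *: e))); last exact/funext.
  rewrite -[X in _ --> X](scale0r (t *: e)).
  by apply: cvgZl; apply: cvg_expr.
have it n : (iter n (plane_act A) w *m r) 0 0 = lam ^+ n * (w *m r) 0 0.
  elim: n => [|n IH]; first by rewrite expr0 mul1r.
  by rewrite iterS /plane_act -mulmxA rE -scalemxAr mxE IH exprS mulrA.
have r1 : exists2 M : R, 0 < M & forall w : plane, `|(w *m r) 0 0| <= M * `|w|.
  exists (`|rt 0 0| + `|rt 0 1| + 1) => [|v]; first by rewrite ltr_pwDr ?addr_ge0.
  rewrite mulE (le_trans (ler_normD _ _))// !normrM !mulrDl mul1r.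
  rewrite -[leLHS]addr0 lerD// lerD// mulrC ler_wpM2l//; exact: coord_le_norm.
have [C C0 rM] := r1.
have /cvgr_dist_lt /(_ 1 ltr01) [N _ Nlt] := cv.
(* The bound holds from time [N] on, so the expansion argument is applied to the [N]-th iterate. *)
suff : lam ^+ N * (w *m r) 0 0 = 0.
  move/eqP; rewrite mulf_eq0 expf_eq0 => /orP[/andP[_ /eqP l0]|/eqP //].
  by move: lam1; rewrite l0 normr0 ltr10.
apply: (expansion_bounded lam1 (B := C)) => n.
rewrite mulrA -exprD -it (le_trans (rM _))// -[leRHS]mulr1 ler_wpM2l ?ltW//.
by have /= := Nlt _ (leq_addl n N); rewrite sub0r normrN.
Qed.
End LinearAlgebra.

(** * Topology of the torus *)

Lemma near_right_ex (R : realType) (P : set R) :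
  (\forall e \near 0^'+, P e) -> exists2 e : R, 0 < e & P e.
Proof.
move=> near0.
have near1 : \forall e \near 0^'+, P e /\ 0 < e.
  by apply: filterI; [exact: near0|exact: nbhs_right_gt].
by have [e [Pe e0]] := @filter_ex _ _ (at_right_proper_filter (0 : R)) _ near1; exists e.
Qed.

Section TorusTopology.
Variable R : realType.
Local Notation plane := 'rV[R]_2.
Local Notation integral v := (v \is a mxOver Num.int).

Lemma int_vecB (v w : plane) : integral v -> integral w -> integral (v - w).
Proof. by move=> /mxOverP iv /mxOverP iw; apply/mxOverP => i j; rewrite !mxE rpredB. Qed.

Lemma int_vec0 : integral (0 : plane).
Proof. by apply/mxOverP => i j; rewrite mxE rpred0. Qed.

Lemma int_vecN (v : plane) : integral v -> integral (- v).
Proof. by rewrite -sub0r; apply: int_vecB int_vec0. Qed.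

Lemma int_vecD (v w : plane) : integral v -> integral w -> integral (v + w).
Proof. by move=> iv iw; rewrite -[w]opprK; apply/int_vecB/int_vecN. Qed.

Lemma tprojP (v w : plane) : tproj v = tproj w <-> integral (v - w).
Proof.
split=> [e|i]; last exact/eqmodP.
by apply/(@eqmodP _ (lattice_equiv R)).
Qed.

Lemma tprojDint (v k : plane) : integral k -> tproj (v + k) = tproj v.
Proof. by move=> ik; apply/tprojP; rewrite addrAC subrr add0r. Qed.

Lemma tproj_surj (a : torus R) : exists v, tproj v = a.
Proof. by exists (repr a); exact: reprK. Qed.

(** Uniqueness of small lifts: two displacements of norm below 1/2 that lift the same pair of points
    coincide. The constants 1/4 further on serve to stay under this bound. *)
Lemma int_vec_small (k : plane) : integral k -> `|k| < 1 -> k = 0.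
Proof.
move=> /mxOverP ik k1; apply/matrixP => i j; rewrite ord1 mxE.
have /intrP[m km] := ik 0 j.
have : `|k 0 j| < 1 by exact: le_lt_trans (coord_le_norm _ _) k1.
by rewrite km -intr_norm ltrz1 -abszE ltz_nat ltnS leqn0 absz_eq0 => /eqP ->.
Qed.

Lemma nbhs_rV (v : plane) (P : set plane) :
  nbhs v P <-> exists2 e : R, 0 < e & forall w, `|w| < e -> P (v + w).
Proof.
split=> [/nbhs_ballP|] [e /= e0 eP].
  exists e => // w we; apply: eP; rewrite mx_norm_ball /ball_ /=.
  by rewrite opprD addNKr normrN.
apply/nbhs_ballP; exists e => // y; rewrite mx_norm_ball /ball_ /= => vy.
by rewrite -[y](subrKC v); apply: eP; rewrite distrC.
Qed.

Lemma near_tproj (v : plane) (P : set (torus R)) :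
  (\forall b \near tproj v, P b) <->
  exists2 e : R, 0 < e & forall w, `|w| < e -> P (tproj (v + w)).
Proof.
split=> [/pi_continuous /nbhs_rV//|[e e0 eP]].
pose B : set (torus R) := [set b | exists2 w, `|w| < e & b = tproj (v + w)].
have op : open B.
  rewrite /open /= /quotient_open openE => x [w we xw].
  have ix : integral (x - (v + w)) by apply/tprojP; rewrite -xw.
  apply/(@nbhs_rV x); exists (e - `|w|) => [|y]; first by rewrite subr_gt0.
  rewrite ltrBrDl => wy; exists (w + y).
    exact: le_lt_trans (ler_normD _ _) wy.
  by apply/tprojP; rewrite [v + _]addrA opprD addrACA subrr addr0.
have : nbhs (tproj v) B.
  by apply: open_nbhs_nbhs; split=> //; exists 0; rewrite ?addr0 ?normr0.
by apply: filterS => _ [w we ->]; exact: eP.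
Qed.

Lemma tproj_continuous : continuous (@tproj R).
Proof. exact: pi_continuous. Qed.

(** Points that no neighbourhoods separate have lifts whose difference is a limit of lattice
    vectors. Two such approximations with different errors, both below 1/2, would differ by a
    nonzero lattice vector of norm less than 1. *)
Lemma torus_hausdorff : hausdorff_space (torus R).
Proof.
move=> a b cl; have [v va] := tproj_surj a; have [w wb] := tproj_surj b.
subst a b; pose u := w - v.
have close (e : R) : 0 < e -> exists2 z, integral (u + z) & `|z| < e.
  move=> e0; have near_e x : nbhs (tproj x) [set b | exists2 z, `|z| < e / 2 & b = tproj (x + z)].
    by apply/near_tproj; exists (e / 2) => [|z ze]; [rewrite divr_gt0|exists z].
  have [_ [[z ze ->] [z' ze' /tprojP]]] := cl _ _ (near_e v) (near_e w).
  move=> iz; exists (z' - z).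
    suff -> : u + (z' - z) = - (v + z - (w + z')) by exact: int_vecN.
    by apply/rowP => j; rewrite !mxE; ring.
  by rewrite (le_lt_trans (ler_normB _ _))// [ltRHS]splitr ltrD.
have [z iz z1] := close 2^-1 ltac:(lra).
suff z0 : z = 0 by apply/tprojP; rewrite -opprB; apply: int_vecN; rewrite -[w - v]addr0 -z0.
apply/eqP/negPn/negP => z0.
have [|z' iz' z'1] := close (Num.min `|z| 2^-1); first by rewrite lt_min normr_gt0 z0 /=; lra.
move: z'1; rewrite lt_min => /andP[z'z z'1].
have : z - z' = 0.
  apply: int_vec_small; last by rewrite (le_lt_trans (ler_normB _ _))//; lra.
  suff -> : z - z' = (u + z) - (u + z') by exact: int_vecB.
  by rewrite opprD addrACA subrr add0r.
by move/subr0_eq => zz'; rewrite -zz' ltxx in z'z.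
Qed.

Lemma torus_compact : compact [set: torus R].
Proof.
pose Q : set plane := [set v | forall i, `[0, 1]%classic (v ord0 i)].
have -> : [set: torus R] = @tproj R @` Q.
  apply/seteqP; split=> // a _; have [v <-] := tproj_surj a.
  exists (\row_j (v 0 j - (Num.floor (v 0 j))%:~R)) => [j|] /=.
    rewrite mxE in_itv /= subr_ge0 floor_le_tmp lerBlDr.
    by have := lt_succ_floor (v ord0 j); rewrite intrD addrC => /ltW.
  apply/tprojP/mxOverP => i j; rewrite !mxE ord1 addrAC subrr add0r rpredN.
  exact: intr_int.
apply: continuous_compact; first exact/continuous_subspaceT/tproj_continuous.
apply: (@rV_compact R 2 (fun=> `[0, 1]%classic)) => i; exact: segment_compact.
Qed.

(** A Lebesgue number argument for pairs of lifts. The uniform radii around compact sets of the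
    torus come from here. *)
Lemma torus_lebesgue (K : set (torus R)) (Q : plane -> plane -> Prop) :
  compact K ->
  (forall v w k, integral k -> Q v w -> Q (v + k) (w + k)) ->
  (forall v, K (tproj v) -> exists2 eta : R, 0 < eta &
     forall v' w', `|v' - v| < eta -> `|w' - v| < eta -> Q v' w') ->
  exists2 eps : R, 0 < eps &
    forall v w, K (tproj v) -> `|w| <= eps -> Q v (v + w).
Proof.
move=> /compact_near_coveringP Kc Qint Qloc.
pose P (eps : R) (a : torus R) :=
  forall v w, tproj v = a -> `|w| <= eps -> Q v (v + w).
have near0 : \forall eps \near 0^'+, K `<=` P eps.
  apply: Kc => a; have [v <-] := tproj_surj a => Ka.
  have [eta eta0 etaQ] := Qloc v Ka.
  have near_v : \forall b \near tproj v, exists2 v',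
      tproj v' = b & `|v' - v| < eta / 2.
    apply/near_tproj; exists (eta / 2) => [|w we]; first by rewrite divr_gt0.
    by exists (v + w) => //; rewrite addrAC subrr add0r.
  have near0 : \forall eps \near 0^'+, eps < eta / 2.
    by apply: nbhs_right_lt; rewrite divr_gt0.
  near=> b eps => /= v1 w v1b we.
  have [v' v'b v'v] : exists2 v', tproj v' = b & `|v' - v| < eta / 2 by near: b.
  have lt : eps < eta / 2 by near: eps.
  have ik : integral (v1 - v') by apply/tprojP; rewrite v1b v'b.
  rewrite -[v1](subrKC v') addrAC; apply: Qint => //; apply: etaQ.
    by lra.
  rewrite addrAC (le_lt_trans (ler_normD _ _))// [ltRHS]splitr ltrD//.
  exact: le_lt_trans lt.
have [eps eps0 epsP] := near_right_ex near0.
by exists eps => // v w Kv we; exact: (epsP _ Kv).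
Unshelve. all: by end_near. Qed.

End TorusTopology.

(** * Lifts to the plane and multipliers along the stable leaves *)

Lemma cancel_iter (T : Type) (f g : T -> T) n :
  cancel f g -> cancel (iter n f) (iter n g).
Proof. by move=> fK; elim: n => // n IH x; rewrite [LHS]iterSr iterS fK IH. Qed.

Section CountableRange.
Variable R : realType.

(** A non-constant continuous function fills an interval, which has positive Lebesgue measure.
    Countability is the right notion because discreteness fails in the application to charts: the
    transverse components of lattice vectors are dense in the line. *)
Lemma continuous_countable_range (g : R -> R) (S : set R) :
  countable S -> {within `[0, 1], continuous g} ->
  (forall t, 0 <= t <= 1 -> S (g t)) -> g 1 = g 0.
Proof.
move=> cS cg gS; apply/eqP/negPn/negP => ne.
have sub : `[Num.min (g 0) (g 1), Num.max (g 0) (g 1)]%classic `<=` S.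
  move=> y /=; rewrite in_itv /= => yb.
  by have [t tI <-] := IVT ler01 cg yb; apply: gS; move: tI; rewrite in_itv.
have := countable_lebesgue_measure0 (sub_countable (subset_card_le sub) cS).
rewrite lebesgue_measure_itv /= lte_fin.
have lt : Num.min (g 0) (g 1) < Num.max (g 0) (g 1).
  by move: ne; rewrite neq_lt gt_min !lt_max !ltxx !orbF /= orbC.
by rewrite lt -EFinB => -[] /eqP; rewrite subr_eq0 => /eqP h; rewrite h ltxx in lt.
Qed.
End CountableRange.

Lemma mean_value_rV2 (R : realType) (H : 'rV[R]_2 -> 'rV[R]_2) v w B :
  (forall x, differentiable H x) ->
  (forall s, 0 <= s <= 1 -> `|'d H (v + s *: w) w| <= B) ->
  `|H (v + w) - H v| <= B.
Proof.
move=> dH HB.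
pose g (j : 'I_2) (s : R) : R := H (v + s *: w) 0 j.
have dg j (s : R) : is_derive s (1 : R) (g j) ('d H (v + s *: w) w 0 j : R).
  pose x := v + s *: w.
  have dx : derivable H x w by exact: diff_derivable.
  have dj : derivable (fun y => H y 0 j) x w by move/derivable_mxP: dx; apply.
  have eqg : (fun h : R => h^-1 *: ((g j \o shift s) (h *: 1) - g j s)) =
      (fun h : R => h^-1 *: (((fun y => H y 0 j) \o shift x) (h *: w) - H x 0 j)).
    apply/funext => h; rewrite /g /x /= [h *: 1]mulr1 scalerDl.
    by rewrite addrCA.
  split; first by rewrite /derivable eqg.
  by rewrite -deriveE// derive_mx// mxE /derive -eqg.
apply: norm_le_coord => [|j].
  by apply: le_trans (HB 0 _); rewrite ?normr_ge0 ?lexx ?ler01.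
have cg : {within `[0, 1], continuous (g j)}.
  apply: derivable_within_continuous => s _; exact: ex_derive.
have [s sI] := MVT_segment ler01 (fun s _ => dg j s) cg.
rewrite subr0 mulr1 /g scale1r scale0r addr0 !mxE => ->.
by rewrite (le_trans (coord_le_norm _ _))// HB.
Qed.

Section StableLift.
Variable R : realType.
Local Notation plane := 'rV[R]_2.
Local Notation integral v := (v \is a mxOver Num.int).

Definition transverse (r : 'cV[R]_2) (w : plane) : R := (w *m r) 0 0.

Lemma ellD r v w : transverse r (v + w) = transverse r v + transverse r w.
Proof. by rewrite /transverse mulmxDl mxE. Qed.

Lemma ellZ r t w : transverse r (t *: w) = t * transverse r w.
Proof. by rewrite /transverse -scalemxAl mxE. Qed.

Lemma ellN r w : transverse r (- w) = - transverse r w.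
Proof. by rewrite -scaleN1r ellZ mulN1r. Qed.

Lemma ellB r v w : transverse r (v - w) = transverse r v - transverse r w.
Proof. by rewrite ellD ellN. Qed.

Lemma ell_bound r : exists2 M : R, 0 < M & forall w, `|transverse r w| <= M * `|w|.
Proof.
exists (\sum_k `|r k 0| + 1) => [|w]; first by rewrite ltr_wpDl ?sumr_ge0.
rewrite /transverse mxE (le_trans (ler_norm_sum _ _ _))// mulrDl mulr_suml mul1r.
rewrite -[leLHS]addr0 lerD//; apply: ler_sum => k _.
by rewrite normrM mulrC ler_wpM2l//; exact: coord_le_norm.
Qed.

Lemma ell_continuous r : continuous (transverse r).
Proof.
have [M M0 rM] := ell_bound r.
move=> v; apply: (proj2 (@cvgrPdist_lt _ R _ (nbhs (v : plane)) _ (transverse r) (transverse r v))) => eps eps0.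
apply/nbhs_rV.
exists (eps / M) => [|w we] /=; first by rewrite divr_gt0.
rewrite ellD opprD addNKr normrN (le_lt_trans (rM _))//.
by rewrite mulrC -ltr_pdivlMr.
Qed.

(** What is kept of the diffeomorphism once a lift is chosen. The law [sl_F] is exact because, up to
    a constant, the lift differs from the linear map by stable vectors. *)
Record stable_lift (A : 'M[int]_2) (F G : plane -> plane) (e : plane)
    (r : 'cV[R]_2) (kap lam : R) : Prop := StableLift {
  sl_FK : cancel F G;
  sl_GK : cancel G F;
  sl_FC1 : C1_map F;
  sl_GC1 : C1_map G;
  sl_e0 : e != 0;
  sl_eA : plane_act A e = kap *: e;
  sl_kap : `|kap| < 1;
  sl_lam : 1 < `|lam|;
  sl_elle : transverse r e = 0;
  sl_ker : forall w, transverse r w = 0 -> exists t, w = t *: e;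
  sl_F : forall v w, transverse r (F v - F w) = lam * transverse r (v - w);
  sl_int : forall v k, integral k ->
    F (v + k) = F v + plane_act A k }.

Section WithLift.
Variables (A : 'M[int]_2) (F G : plane -> plane) (e : plane).
Variables (r : 'cV[R]_2) (kap lam : R).
Hypothesis SL : stable_lift A F G e r kap lam.
Local Notation ell := (transverse r).

Lemma iter_ell n v w :
  ell (iter n F v - iter n F w) = lam ^+ n * ell (v - w).
Proof.
elim: n => [|n IH]; first by rewrite mul1r.
by rewrite !iterS (sl_F SL) IH exprS mulrA.
Qed.

Lemma iter_ell_inv n v w :
  ell (iter n G v - iter n G w) = lam ^- n * ell (v - w).
Proof.
have lam0 : lam ^+ n != 0.
  by rewrite expf_neq0 // -normr_gt0 (lt_trans _ (sl_lam SL)).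
apply: (mulfI lam0); rewrite mulrA divff// mul1r -iter_ell.
by rewrite !(cancel_iter n (sl_GK SL)).
Qed.

Lemma differentiable_iter (H : plane -> plane) n :
  (forall v, differentiable H v) -> forall v, differentiable (iter n H) v.
Proof.
move=> dH; elim: n => [|n IH] v; first by have [] := is_diff_id v.
exact: differentiable_comp.
Qed.

Lemma ell_diff (H : plane -> plane) c v w : differentiable H v ->
  (forall x y, ell (H x - H y) = c * ell (x - y)) ->
  ell ('d H v w) = c * ell w.
Proof.
move=> dH Hc.
have cv : h^-1 *: ((H \o shift v) (h *: w) - H v) @[h --> 0^'] --> 'd H v w.
  by rewrite -deriveE//; exact: diff_derivable.
have cv2 := continuous_cvg _ (@ell_continuous r ('d H v w)) cv.
have cv3 : ell (h^-1 *: ((H \o shift v) (h *: w) - H v)) @[h --> 0^'] --> c * ell w.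
  apply: (@cvg_trans _ ((fun=> c * ell w) @ (0^' : set_system R))); last exact: cvg_cst.
  apply: near_eq_cvg; near=> h.
  rewrite ellZ /= Hc addrK ellZ mulrCA mulKf//.
  by near: h; exact: nbhs_dnbhs_neq.
exact: (cvg_unique (@Rhausdorff R) (cv2 _) cv3).
Unshelve. all: by end_near. Qed.

End WithLift.
End StableLift.

Lemma enormZ (R : realType) (s : R) (v : 'rV[R]_2) : enorm (s *: v) = `|s| * enorm v.
Proof.
rewrite /enorm (eq_bigr (fun j => s ^+ 2 * v 0 j ^+ 2)) => [|j _]; last first.
  by rewrite mxE exprMn.
by rewrite -mulr_sumr sqrtrM ?sqr_ge0// sqrtr_sqr.
Qed.

Lemma enorm_coord (R : realType) (v : 'rV[R]_2) j : `|v 0 j| <= enorm v.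
Proof.
rewrite /enorm -sqrtr_sqr ler_wsqrtr// (bigD1 j)//= lerDl.
by apply: sumr_ge0 => i _; exact: sqr_ge0.
Qed.

Lemma enorm_ge0 (R : realType) (v : 'rV[R]_2) : 0 <= enorm v.
Proof. exact: sqrtr_ge0. Qed.

Lemma enorm_gt0 (R : realType) (v : 'rV[R]_2) : v != 0 -> 0 < enorm v.
Proof.
move=> v0; rewrite lt_neqAle enorm_ge0 andbT eq_sym; apply: contra v0 => /eqP e0.
apply/eqP/rowP => j; rewrite mxE; apply/eqP; rewrite -normr_le0 -e0.
exact: enorm_coord.
Qed.

Lemma continuous_rV2 (R : realType) (T : topologicalType) (g : T -> 'rV[R]_2) x :
  (forall j, {for x, continuous (fun y => g y 0 j)}) -> {for x, continuous g}.
Proof.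
move=> cg; apply: (proj2 (@cvgrPdist_le _ 'rV[R]_2 _ (nbhs x) _ g (g x))) => eps eps0.
have near_j j : \forall y \near x, `|g x 0 j - g y 0 j| <= eps.
  exact: (proj1 (@cvgrPdist_le _ R _ (nbhs x) _ _ _) (cg j)).
near=> y; apply: norm_le_coord => [|j]; first exact: ltW.
rewrite !mxE.
have [->|->] : j = 0 \/ j = 1
  by case: j => [[|[|//]] ?]; [left|right]; exact/val_inj.
- by near: y; exact: (near_j 0).
- by near: y; exact: (near_j 1).
Unshelve. all: by end_near. Qed.

Lemma diff_comp_eigen (R : numFieldType) (U V : normedModType R) (H : U -> U)
    (K : U -> V) v e s :
  differentiable H v -> differentiable K (H v) -> 'd H v e = s *: e ->
  'd (K \o H) v e = s *: 'd K (H v) e.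
Proof. by move=> dH dK es; rewrite diff_comp//= es linearZ. Qed.

Lemma diffZ (R : numFieldType) (U V : normedModType R) (K : U -> V) v e s :
  'd K v (s *: e) = s *: 'd K v e.
Proof. exact: linearZ. Qed.

Lemma diff_idE (R : numFieldType) (U : normedModType R) (v e : U) : 'd id v e = e.
Proof. by rewrite diff_val. Qed.

Section Multiplier.
Variable R : realType.
Local Notation plane := 'rV[R]_2.
Local Notation integral v := (v \is a mxOver Num.int).
Variables (A : 'M[int]_2) (F G : plane -> plane) (e : plane).
Variables (r : 'cV[R]_2) (kap lam : R).
Hypothesis SL : stable_lift A F G e r kap lam.
Local Notation ell := (transverse r).

(** The stretching factor along the stable line. When [H] multiplies the transverse component by a
    constant, its differential preserves the line of [e], and this is the absolute value of the
    eigenvalue there. *)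
Definition leaf_mult (H : plane -> plane) (v : plane) : R := `|'d H v e| / `|e|.

Let e_gt0 : 0 < `|e|. Proof. by rewrite normr_gt0 (sl_e0 SL). Qed.

Let dF v : differentiable F v. Proof. by have [] := sl_FC1 SL. Qed.
Let dG v : differentiable G v. Proof. by have [] := sl_GC1 SL. Qed.

Lemma diff_leaf (H : plane -> plane) c v : differentiable H v ->
  (forall x y, ell (H x - H y) = c * ell (x - y)) ->
  exists2 s, 'd H v e = s *: e & leaf_mult H v = `|s|.
Proof.
move=> dH Hc; have := ell_diff e dH Hc.
rewrite (sl_elle SL) mulr0 => /(sl_ker SL)[s es]; exists s => //.
by rewrite /leaf_mult es normrZ mulfK// gt_eqF.
Qed.

Lemma leaf_mult_mean_value (H : plane -> plane) c v w B :
  (forall x, differentiable H x) ->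
  (forall x y, ell (H x - H y) = c * ell (x - y)) ->
  ell w = 0 ->
  (forall s, 0 <= s <= 1 -> leaf_mult H (v + s *: w) <= B) ->
  `|H (v + w) - H v| <= B * `|w|.
Proof.
move=> dH Hc /(sl_ker SL)[t ->] HB; apply: mean_value_rV2 => // s /HB.
rewrite diffZ /leaf_mult ler_pdivrMr// => le_sB.
by rewrite [leLHS]normrZ normrZ mulrCA ler_wpM2l.
Qed.

Lemma leaf_mult_comp (H K : plane -> plane) c v :
  differentiable H v -> differentiable K (H v) ->
  (forall x y, ell (H x - H y) = c * ell (x - y)) ->
  leaf_mult (K \o H) v = leaf_mult K (H v) * leaf_mult H v.
Proof.
move=> dH dK /(diff_leaf dH)[s es ->].
have E : 'd (K \o H) v e = s *: 'd K (H v) e.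
  exact (diff_comp_eigen dH dK es).
apply: (eq_trans (congr1 (fun x => `|x| / `|e|) E)).
by rewrite normrZ -mulrA mulrC.
Qed.

Lemma leaf_multD n m v :
  leaf_mult (iter (n + m) F) v =
  leaf_mult (iter n F) (iter m F v) * leaf_mult (iter m F) v.
Proof.
rewrite -(@leaf_mult_comp _ _ (lam ^+ m)).
- by congr (leaf_mult _ v); apply/funext => x; rewrite iterD.
- exact: differentiable_iter.
- exact: differentiable_iter.
- exact: (iter_ell SL).
Qed.

Lemma leaf_mult_inv n v :
  leaf_mult (iter n G) v * leaf_mult (iter n F) (iter n G v) = 1.
Proof.
rewrite mulrC -(@leaf_mult_comp _ _ (lam ^- n)).
- rewrite /leaf_mult (_ : _ \o _ = id); last first.
    by apply/funext => x /=; rewrite (cancel_iter n (sl_GK SL)).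
  by rewrite diff_idE divff// gt_eqF.
- exact: differentiable_iter.
- exact: differentiable_iter.
- exact: (iter_ell_inv SL).
Qed.

Lemma leaf_mult_ge0 H v : 0 <= leaf_mult H v.
Proof. by rewrite divr_ge0. Qed.

Lemma leaf_mult0 v : leaf_mult (iter 0 F) v = 1.
Proof. by rewrite /leaf_mult diff_idE divff// gt_eqF. Qed.

Lemma iter_F_continuous n : continuous (iter n F).
Proof. by move=> v; apply/differentiable_continuous/differentiable_iter. Qed.

Lemma iter_G_continuous n : continuous (iter n G).
Proof. by move=> v; apply/differentiable_continuous/differentiable_iter. Qed.

(** Continuity is given for the Jacobian of [F]; the chain rule carries it to the iterates. *)
Lemma leaf_mult_continuous n : continuous (leaf_mult (iter n F)).
Proof.
elim: n => [|n IH] v.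
  have -> : leaf_mult (iter 0 F) = cst 1 by apply/funext => x; exact: leaf_mult0.
  exact: cst_continuous.
have -> : leaf_mult (iter n.+1 F) =
    (leaf_mult (iter n F) \o iter 1 F) \* leaf_mult F.
  apply/funext => x; rewrite /= -[leaf_mult F]/(leaf_mult (iter 1 F)).
  by rewrite -[F x]/(iter 1 F x) -leaf_multD addn1.
have c1 : {for v, continuous (leaf_mult (iter n F) \o iter 1 F)}.
  by apply: continuous_comp; [exact: iter_F_continuous|exact: IH].
suff c2 : {for v, continuous (leaf_mult F)} by exact: cvgM c1 c2.
have -> : leaf_mult F = fun v => `|e *m 'J F v| / `|e|.
  by apply/funext => x; rewrite -deriveEjacobian// deriveE.
have [_ FJ] := sl_FC1 SL.
have c3 : {for v, continuous (fun v => e *m 'J F v)}.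
  apply: continuous_rV2 => j.
  have -> : (fun v => (e *m 'J F v) 0 j) = fun v => e 0 ord0 * 'J F v ord0 j +
      e 0 (lift ord0 ord0) * 'J F v (lift ord0 ord0) j.
    by apply/funext => x; rewrite mxE !big_ord_recl big_ord0 addr0.
  have cJ k : {for v, continuous (fun v => 'J F v k j)}.
    apply: (@continuous_comp _ _ _ (fun v => 'J F v) (fun M : 'M[R]_(2, 2) => M k j)).
      exact: FJ.
    exact: coord_continuous.
  exact: cvgD (cvgMr (cJ _)) (cvgMr (cJ _)).
have c4 : {for v, continuous (Num.norm \o (fun v => e *m 'J F v))}.
  by apply: continuous_comp c3 _; exact: norm_continuous.
exact: cvgMl c4.
Qed.

Lemma integral_act (k : plane) : integral k -> integral (plane_act A k).
Proof.
move=> /mxOverP ik; apply/mxOverP => i j; rewrite mxE rpred_sum// => l _.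
by rewrite mxE rpredM// intr_int.
Qed.

Lemma iter_int n (k : plane) : integral k ->
  exists2 k', integral k' & forall v, iter n F (v + k) = iter n F v + k'.
Proof.
elim: n => [|n IH] ik; first by exists k.
have [k' ik' Fk'] := IH ik; exists (plane_act A k'); first exact: integral_act.
by move=> v; rewrite !iterS Fk' (sl_int SL).
Qed.

Lemma leaf_mult_int n v k : integral k ->
  leaf_mult (iter n F) (v + k) = leaf_mult (iter n F) v.
Proof.
move=> /(iter_int n)[k' ik' Fk'].
have dE x : 'd (iter n F) x e = 'D_e (iter n F) x.
  by rewrite deriveE//; exact: differentiable_iter.
have DE : 'D_e (iter n F) (v + k) = 'D_e (iter n F) v.
  have Eq : (fun h : R => h^-1 *: ((iter n F \o shift (v + k)) (h *: e) - iter n F (v + k)))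
      = (fun h : R => h^-1 *: ((iter n F \o shift v) (h *: e) - iter n F v)).
    by apply/funext => h /=; rewrite addrA !Fk' opprD addrACA subrr addr0.
  by rewrite /derive Eq.
have E : 'd (iter n F) (v + k) e = 'd (iter n F) v e.
  exact (eq_trans (dE _) (eq_trans DE (esym (dE _)))).
apply: (eq_trans (congr1 (fun x => `|x| / `|e|) E)).
by [].
Qed.

End Multiplier.

(* Unfolding it lets unification compare differentials of maps between matrix
   spaces, which does not terminate in practice. *)
Opaque leaf_mult.

(** * Contraction along the stable leaves *)

Lemma dist_gt (R : realDomainType) (x y c : R) : `|x - y| < y - c -> c < x.
Proof. by rewrite ltr_norml => /andP[+ _]; lra. Qed.

Lemma dist_lt (R : realDomainType) (x y c : R) : `|x - y| < c - y -> x < c.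
Proof. by rewrite ltr_norml => /andP[_ +]; lra. Qed.

Lemma periodic_bounded (R : realType) (u : 'rV[R]_2 -> R) :
  continuous u ->
  (forall v k, k \is a mxOver Num.int -> u (v + k) = u v) ->
  exists B, forall v, u v <= B.
Proof.
move=> cu per.
have /compact_near_coveringP tc := torus_compact (R := R).
pose P (B : R) (a : torus R) := forall v, tproj v = a -> u v <= B.
have nearB : \forall B \near +oo, [set: torus R] `<=` P B.
  apply: tc => a _; have [v <-] := tproj_surj a.
  have near1 : \forall b \near tproj v, forall v', tproj v' = b -> u v' <= u v + 1.
    have : \forall v' \near v, u v' < u v + 1.
      by apply: (cvgr_lt _ (cu v)); rewrite ltrDl.
    move=> /nbhs_rV[d d0 dP]; apply/near_tproj; exists d => // w wd v' /tprojP iv.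
    by rewrite -(subrKC (v + w) v') per// ltW// dP.
  have near2 : \forall B \near +oo, u v + 1 <= B by apply: nbhs_pinfty_ge; exact: num_real.
  near=> b B => /= v' v'b.
  have h : forall v', tproj v' = b -> u v' <= u v + 1 by near: b.
  by apply: (le_trans (h _ v'b)); near: B.
have [B BP] := filter_ex nearB.
by exists B => v; exact: (BP (tproj v)).
Unshelve. all: by end_near. Qed.

Section Hyperbolic.
Variable R : realType.
Local Notation plane := 'rV[R]_2.
Local Notation integral v := (v \is a mxOver Num.int).
Variables (f : homeo (torus R) (torus R)).
Variables (A : 'M[int]_2) (F G : plane -> plane) (e : plane).
Variables (r : 'cV[R]_2) (kap lam : R).
Hypothesis SL : stable_lift A F G e r kap lam.
Hypothesis tF : forall v, tproj (F v) = f (tproj v).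
Local Notation ell := (transverse r).
Local Notation mult := (leaf_mult e).

Let e_gt0 : 0 < `|e|. Proof. by rewrite normr_gt0 (sl_e0 SL). Qed.
Let dF n v : differentiable (iter n F) v.
Proof. by apply: differentiable_iter => x; have [] := sl_FC1 SL. Qed.
Let dG n v : differentiable (iter n G) v.
Proof. by apply: differentiable_iter => x; have [] := sl_GC1 SL. Qed.

Lemma iterF_ball n v eps : 0 < eps -> exists2 d : R, 0 < d &
  forall w, `|w| < d -> `|iter n F (v + w) - iter n F v| < eps.
Proof.
move=> eps0; have cF : {for v, continuous (iter n F)} by exact: (iter_F_continuous SL).
have [d d0 dP] := proj1 (nbhs_rV _ _) (cvgr_distC_lt (iter n F) (iter n F v) cF eps eps0).
by exists d.
Qed.

Lemma mult_ball n v eps : 0 < eps -> exists2 d : R, 0 < d &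
  forall w, `|w| < d -> `|mult (iter n F) (v + w) - mult (iter n F) v| < eps.
Proof.
move=> eps0.
have cF : {for v, continuous (mult (iter n F))} by exact: (leaf_mult_continuous SL).
have [d d0 dP] := proj1 (nbhs_rV _ _) (cvgr_distC_lt (mult (iter n F)) (mult (iter n F) v) cF eps eps0).
by exists d.
Qed.

Lemma tproj_G v : tproj (G v) = bwd f (tproj v).
Proof. by rewrite -[v in RHS](sl_GK SL) tF fwdK. Qed.

Lemma tproj_iterF n v : tproj (iter n F v) = iter n f (tproj v).
Proof. by elim: n => // n IH; rewrite !iterS tF IH. Qed.

Lemma tproj_iterG n v : tproj (iter n G v) = iter n (bwd f) (tproj v).
Proof. by elim: n => // n IH; rewrite !iterS tproj_G IH. Qed.

Lemma iterG_int n v k : integral k -> integral (iter n G (v + k) - iter n G v).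
Proof. by move=> ik; apply/tprojP; rewrite !tproj_iterG tprojDint. Qed.

Lemma iterF_uniform n eps : 0 < eps -> exists2 d : R, 0 < d &
  forall v w, `|w| <= d -> `|iter n F (v + w) - iter n F v| <= eps.
Proof.
move=> eps0.
have [d d0 dP] : exists2 d : R, 0 < d & forall v w, [set: torus R] (tproj v) ->
    `|w| <= d -> `|iter n F (v + w) - iter n F v| <= eps.
  apply: (torus_lebesgue (Q := fun v w => `|iter n F w - iter n F v| <= eps)).
  - exact: torus_compact.
  - move=> v w k /(iter_int SL n)[k' _ Fk'].
    by rewrite !Fk' opprD addrACA subrr addr0.
  move=> v _; have [d d0 dP] := iterF_ball n v (divr_gt0 eps0 (ltr0n _ 2)).
  exists d => // v' w' v'd w'd.
  have h1 := dP _ v'd; have h2 := dP _ w'd; rewrite !subrKC in h1 h2.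
  rewrite -(subrKA (iter n F v)) (le_trans (ler_normD _ _))//.
  by rewrite [leRHS]splitr lerD// ltW// distrC.
by exists d => // v w; exact: dP.
Qed.

(** The difference between [F] and the linear map is periodic, hence bounded by some [B], and the
    linear map shortens stable vectors. So [M] is twice [B]. *)
Lemma leaf_displacement_bound : exists M, forall v w, ell w = 0 ->
  `|F (v + w) - F v| <= `|w| + M.
Proof.
pose u v := `|F v - plane_act A v|.
have [B uB] : exists B, forall v, u v <= B.
  apply: periodic_bounded => [v|v k ik].
    have cA : {for v, continuous (@plane_act R A)}.
      apply: continuous_rV2 => j.
      have -> : (fun y => plane_act A y 0 j) = transverse (R := R) (col j (map_mx intr A)).
        by apply/funext => y; rewrite /plane_act /transverse !mxE; apply: eq_bigr => l _; rewrite !mxE.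
      exact: ell_continuous.
    have c1 : {for v, continuous (fun v => F v - plane_act A v)}.
      have cF : {for v, continuous F} by exact: (@iter_F_continuous _ _ _ _ _ _ _ _ SL 1).
      exact: (@cvgB _ _ _ (nbhs v) _ F (plane_act A) _ _ cF cA).
    exact: (@cvg_norm _ _ _ (nbhs v) _ _ _ c1).
  by rewrite /u (sl_int SL)// /plane_act mulmxDl opprD addrACA subrr addr0.
exists (B + B) => v w ew; have [t wt] := sl_ker SL ew.
have -> : F (v + w) - F v = (F (v + w) - plane_act A (v + w)) -
    (F v - plane_act A v) + plane_act A w.
  have -> : plane_act A (v + w) = plane_act A v + plane_act A w.
    by rewrite /plane_act mulmxDl.
  move: (plane_act A v) (plane_act A w) (F (v + w)) (F v) => a b c x.
  by apply/rowP => j; rewrite !mxE; ring.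
rewrite addrC (le_trans (ler_normD _ _))// lerD//.
  rewrite wt /plane_act -scalemxAl -/(plane_act A e) (sl_eA SL) scalerA mulrC.
  by rewrite -scalerA normrZ ler_piMl// ltW// (sl_kap SL).
by rewrite (le_trans (ler_normB _ _))// lerD// uB.
Qed.

(** * The stable line of the automorphism against the hyperbolic splitting *)

Section Splitting.
Variables (L : set (torus R)) (Es Eu : torus R -> 'M[R]_2) (C lh : R).
Hypotheses (C0 : 0 < C) (lh01 : 0 < lh < 1).
Hypothesis split_L : forall v, L (tproj v) ->
    [/\ ((Es (tproj v) + Eu (tproj v))%MS :=: 1%:M)%MS /\
        (Es (tproj v) :&: Eu (tproj v) :=: (0 : 'M[R]_2))%MS,
        (Es (tproj v) *m 'J F v :=: Es (f (tproj v)))%MS,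
        (Eu (tproj v) *m 'J F v :=: Eu (f (tproj v)))%MS,
        forall (w : plane) n, (w <= Es (tproj v))%MS ->
          enorm (w *m 'J (iter n F) v) <= C * lh ^+ n * enorm w &
        forall (w : plane) n, (w <= Eu (tproj v))%MS ->
          enorm (w *m 'J (iter n G) v) <= C * lh ^+ n * enorm w].

(** A vector of [Es] has bounded forward images, whereas its transverse component grows like
    [lam ^+ n]. So [Es] lies in the line of [e], and is that line or zero. *)
Lemma stable_or_trivial v : L (tproj v) ->
  (e <= Es (tproj v))%MS \/ Es (tproj v) = 0.
Proof.
move=> Lv; have [_ _ _ Esb _] := split_L Lv.
have [->|Es0] := eqVneq (Es (tproj v)) 0; [by right|left].
set w := nz_row (Es (tproj v)).
have w0 : w != 0 by rewrite nz_row_eq0.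
have wE : (w <= Es (tproj v))%MS by exact: nz_row_sub.
have [M M0 rM] := ell_bound r.
have ew : ell w = 0.
  apply: (expansion_bounded (sl_lam SL) (B := M * (C * enorm w))) => n.
  rewrite -(ell_diff w (dF n v) (iter_ell SL n)) -deriveE//.
  rewrite deriveEjacobian// (le_trans (rM _))// ler_pM2l//.
  apply: (@le_trans _ _ (enorm (w *m 'J (iter n F) v))).
    by apply: norm_le_coord => [|j]; [exact: enorm_ge0|exact: enorm_coord].
  rewrite (le_trans (Esb _ n wE))// ler_wpM2r ?enorm_ge0// ger_pMr//.
  by case/andP: lh01 => l0 l1; rewrite exprn_ile1 ?ltW.
have [t wt] := sl_ker SL ew.
have t0 : t != 0 by apply: contra w0 => /eqP t0; rewrite wt t0 scale0r.
by rewrite -[e](scalerK t0) -wt; exact: scalemx_sub.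
Qed.

Lemma mult_le_stable v n : L (tproj v) -> (e <= Es (tproj v))%MS ->
  mult (iter n F) v <= C * lh ^+ n.
Proof.
move=> Lv eE; have [_ _ _ Esb _] := split_L Lv.
have [s es ->] := diff_leaf SL (dF n v) (iter_ell SL n).
have := Esb _ n eE; rewrite -deriveEjacobian// deriveE// es enormZ ler_pM2r//.
exact/enorm_gt0/(sl_e0 SL).
Qed.

Lemma mult_inv_le_unstable v n : L (tproj v) -> Es (tproj v) = 0 ->
  mult (iter n G) v <= C * lh ^+ n.
Proof.
move=> Lv Es0; have [[Efull _] _ _ _ Eub] := split_L Lv.
have eE : (e <= Eu (tproj v))%MS.
  have : (e <= Es (tproj v) + Eu (tproj v))%MS by rewrite Efull submx1.
  by rewrite Es0 adds0mx.
have [s es ->] := diff_leaf SL (dG n v) (iter_ell_inv SL n).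
have := Eub _ n eE; rewrite -deriveEjacobian// deriveE// es enormZ ler_pM2r//.
exact/enorm_gt0/(sl_e0 SL).
Qed.

Lemma stable_forward v : L (tproj v) -> (e <= Es (tproj v))%MS ->
  (e <= Es (tproj (F v)))%MS.
Proof.
move=> Lv eE; have [_ EsF _ _ _] := split_L Lv.
have [s es ms] := diff_leaf SL (dF 1 v) (iter_ell SL 1).
have s0 : s != 0.
  have := leaf_mult_inv SL 1 (F v); rewrite /= (sl_FK SL).
  rewrite [leaf_mult e _ v]ms => h; apply/eqP => s0; move: h.
  by rewrite s0 normr0 mulr0 => /eqP; rewrite eq_sym oner_eq0.
rewrite tF -EsF -[e](scalerK s0); apply: scalemx_sub.
have <- : e *m 'J F v = s *: e.
  by rewrite -es -deriveE ?deriveEjacobian//; exact: (dF 1 v).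
exact: submxMr.
Qed.

Lemma trivial_forward v : L (tproj v) -> Es (tproj v) = 0 -> Es (tproj (F v)) = 0.
Proof.
move=> Lv Es0; have [_ EsF _ _ _] := split_L Lv.
by apply/eqP; rewrite -submx0 tF -EsF Es0 mul0mx.
Qed.

Lemma dense_closed (P : plane -> Prop) v0 :
  L `<=` closure [set iter n f (tproj v0) | n in [set: nat]] ->
  (forall k, P (iter k F v0)) ->
  (forall v k : plane, integral k -> P (v + k) -> P v) ->
  (forall v : plane, ~ P v -> exists2 d : R, 0 < d & forall w : plane, `|w| < d -> ~ P (v + w)) ->
  forall v, L (tproj v) -> P v.
Proof.
move=> dense Pv0 Pint Pclosed v Lv; apply: contrapT => /Pclosed[d d0 dP].
have [_ [[k _ <-] [w wd]]] : ([set iter n f (tproj v0) | n in [set: nat]] `&`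
    [set b | exists2 w, `|w| < d & tproj (v + w) = b]) !=set0.
  by apply: (dense _ Lv); apply/near_tproj; exists d => // w wd; exists w.
rewrite -tproj_iterF => /tprojP ik; apply: (dP _ wd).
by have := Pint (v + w) _ (int_vecN ik); rewrite opprB subrKC; apply.
Qed.

(** The case that occurs at the base point of the dense orbit is carried along that orbit. The
    passage to all of [L] is made on the inequalities, which are closed conditions on a continuous
    multiplier, and not on the subspaces. *)
Lemma mult_alternative v0 : L (tproj v0) -> (forall v, L (tproj v) -> L (tproj (F v))) ->
  L `<=` closure [set iter n f (tproj v0) | n in [set: nat]] ->
  (forall v n, L (tproj v) -> mult (iter n F) v <= C * lh ^+ n) \/
  (forall v n, L (tproj v) -> 1 <= C * lh ^+ n * mult (iter n F) v).
Proof.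
move=> Lv0 LF dense.
have LFk k : L (tproj (iter k F v0)) by elim: k => // k; exact: LF.
have [eE|Es0] := stable_or_trivial Lv0; [left|right] => v n.
  have eEk k : (e <= Es (tproj (iter k F v0)))%MS.
    by elim: k => // k; exact: stable_forward.
  move: v; apply: (dense_closed dense) => [k|v k ik|v].
  - exact: mult_le_stable.
  - by rewrite (leaf_mult_int SL).
  move=> /negP; rewrite -ltNge => lt.
  have [d d0 dP] := mult_ball n v (ltac:(by rewrite subr_gt0; exact: lt) : 0 < mult (iter n F) v - C * lh ^+ n).
  by exists d => // w /dP /dist_gt h; apply/negP; rewrite -ltNge.
have Esk k : Es (tproj (iter k F v0)) = 0.
  by elim: k => // k; exact: trivial_forward.
move: v; apply: (dense_closed dense) => [k|v k ik|v].
- rewrite -(leaf_mult_inv SL n (iter (n + k) F v0)) iterD.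
  rewrite (cancel_iter n (sl_FK SL)) ler_wpM2r ?leaf_mult_ge0//.
  by rewrite -iterD; exact: mult_inv_le_unstable.
- by rewrite (leaf_mult_int SL).
move=> /negP; rewrite -ltNge => lt.
have m0 : 0 <= mult (iter n F) v by exact: leaf_mult_ge0.
have B0 : 0 < C * lh ^+ n by rewrite mulr_gt0// exprn_gt0//; case/andP: lh01.
pose eps := (C * lh ^+ n)^-1 - mult (iter n F) v.
have eps0 : 0 < eps by rewrite subr_gt0 -[_^-1]mul1r ltr_pdivlMr// mulrC.
have [d d0 dP] := mult_ball n v eps0.
exists d => // w /dP /dist_lt h; apply/negP; rewrite -ltNge.
by rewrite mulrC -ltr_pdivlMr// mul1r.
Qed.

End Splitting.
End Hyperbolic.

Section Contraction.
Variable R : realType.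
Local Notation plane := 'rV[R]_2.
Local Notation integral v := (v \is a mxOver Num.int).
Variables (f : homeo (torus R) (torus R)).
Variables (A : 'M[int]_2) (F G : plane -> plane) (e : plane).
Variables (r : 'cV[R]_2) (kap lam : R).
Hypothesis SL : stable_lift A F G e r kap lam.
Hypothesis tF : forall v, tproj (F v) = f (tproj v).
Local Notation ell := (transverse r).
Local Notation mult := (leaf_mult e).

Let e_gt0 : 0 < `|e|. Proof. by rewrite normr_gt0 (sl_e0 SL). Qed.
Let dF n v : differentiable (iter n F) v.
Proof. by apply: differentiable_iter => x; have [] := sl_FC1 SL. Qed.
Let dG n v : differentiable (iter n G) v.
Proof. by apply: differentiable_iter => x; have [] := sl_GC1 SL. Qed.
Let tG v : tproj (G v) = bwd f (tproj v) := tproj_G SL tF v.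

Lemma ell_iterF n v w : ell w = 0 -> ell (iter n F (v + w) - iter n F v) = 0.
Proof. by move=> ew; rewrite (iter_ell SL) addrAC subrr add0r ew mulr0. Qed.

Lemma ell_iterG n v w : ell w = 0 -> ell (iter n G (v + w) - iter n G v) = 0.
Proof. by move=> ew; rewrite (iter_ell_inv SL) addrAC subrr add0r ew mulr0. Qed.

Lemma iter_displacement_bound N : exists M, forall v w, ell w = 0 ->
  `|iter N F (v + w) - iter N F v| <= `|w| + M.
Proof.
have [M MP] := leaf_displacement_bound SL.
elim: N => [|N [M' IH]].
  by exists 0 => v w _; rewrite /= addrAC subrr add0r addr0.
exists (M' + M) => v w ew; rewrite !iterS addrA.
rewrite -[iter N F (v + w)](subrKC (iter N F v)).
by rewrite (le_trans (MP _ _ (ell_iterF _ _ ew)))// lerD2r IH.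
Qed.

(* If [f] were uniformly expanding along the stable leaves over the attractor
   [L], then [L] would contain whole stable lines, while [F] is at bounded
   distance from a map contracting these lines. *)
Lemma not_expanding (L U : set (torus R)) (B : nat -> R) v0 :
  open U -> L `<=` U -> f @` closure U `<=` U ->
  L = \bigcap_n (iter n f @` U) -> compact L -> f @` L = L ->
  L (tproj v0) -> (forall eps, 0 < eps -> exists n, B n < eps) ->
  ~ (forall v n, L (tproj v) -> 1 <= B n * mult (iter n F) v).
Proof.
move=> Uo LU fU LE Lc fL Lv0 Bsmall expand.
(* An expansion by 4 on [L] is still at least 2 close to [L]. *)
have [N BN] := Bsmall 4^-1 ltac:(by []).
have mult4 v : L (tproj v) -> 4 <= mult (iter N F) v.
  move=> /(expand _ N); have := leaf_mult_ge0 e (iter N F) v.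
  by move: (mult _ v) => m m0 h; nra.
have N0 : (0 < N)%N.
  rewrite lt0n; apply/eqP => N0; have := mult4 _ Lv0.
  by rewrite N0 (leaf_mult0 SL); lra.
have LF v : L (tproj v) -> L (tproj (F v)).
  by move=> Lv; rewrite tF -fL; exists (tproj v).
have LG v : L (tproj v) -> L (tproj (G v)).
  by rewrite tG -{1}fL => -[a La <-]; rewrite fwdK.
have LGn n v : L (tproj v) -> L (tproj (iter n G v)).
  by move=> Lv; elim: n => // n; exact: LG.
have LFn n v : L (tproj v) -> L (tproj (iter n F v)).
  by move=> Lv; elim: n => // n; exact: LF.
(* The multiplier is taken at [iter N G w] so that its inverse is the multiplier of the backward map
   at [w]. *)
pose Q (v w : plane) := U (tproj w) /\ 2 <= mult (iter N F) (iter N G w).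
have [d d0 dQ] : exists2 d : R, 0 < d &
    forall v w, L (tproj v) -> `|w| <= d -> Q v (v + w).
  apply: (torus_lebesgue (K := L) (Q := Q) Lc) => [v w k ik [Uw mw]|v Lv].
    split; first by rewrite tprojDint.
    have := iterG_int SL tF N w ik.
    by move=> /(leaf_mult_int SL N (iter N G w)); rewrite subrKC => ->.
  have [d1 d10 d1P] : exists2 d : R, 0 < d & forall w, `|w| < d -> U (tproj (v + w)).
    by apply/near_tproj; apply: open_nbhs_nbhs; split=> //; exact: LU.
  have [d2 d20 d2P] := mult_ball SL N (iter N G v) (ltac:(lra) : (0 : R) < 2).
  have cG : {for v, continuous (iter N G)} by exact: (iter_G_continuous SL).
  have [d3 d30 d3P] := proj1 (nbhs_rV _ _)
    (cvgr_distC_lt (iter N G) (iter N G v) cG d2 d20).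
  exists (Num.min d1 d3); first by rewrite lt_min d10.
  move=> v' w' _; rewrite lt_min => /andP[w1 w3]; rewrite /Q -(subrKC v w').
  split; first exact: d1P.
  have h := d2P _ (d3P _ w3); rewrite !subrKC in h; rewrite subrKC.
  have := mult4 _ (LGn N _ Lv); move: h.
  move: (mult (iter N F) (iter N G w')) (mult (iter N F) (iter N G v)) => a b.
  by rewrite ltr_norml => /andP[+ _]; lra.
have mG v w : L (tproj v) -> `|w| <= d -> mult (iter N G) (v + w) <= 2^-1.
  move=> Lv wd; have [_] := dQ v w Lv wd; have := leaf_mult_inv SL N (v + w).
  have := leaf_mult_ge0 e (iter N G) (v + w).
  by move: (mult _ _) (mult _ _) => a b; nra.
(* Backward blocks of [N] steps halve stable displacements, so a point close to [L] on a stable line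
   returns close to [L], hence to [U], after each block. *)
have stay k v w : L (tproj v) -> ell w = 0 -> `|w| <= d ->
    U (tproj (iter (k * N) G (v + w))).
  elim: k v w => [|k IH] v w Lv ew wd; first by have [] := dQ v w Lv wd.
  rewrite mulSn addnC iterD -[iter N G _](subrKC (iter N G v)).
  apply: IH; [exact: LGn|exact: ell_iterG|].
  have := @leaf_mult_mean_value _ _ _ _ _ _ _ _ SL (iter N G) _ v w 2^-1 (dG N)
    (iter_ell_inv SL N) ew.
  move=> h; apply: (le_trans (h _)) => [s /andP[s0 s1]|].
    by apply: mG => //; rewrite normrZ ger0_norm// (le_trans _ wd)// ler_piMl.
  by have := normr_ge0 w; lra.
have fUn n b : U b -> U (iter n f b).
  by move=> Ub; elim: n => // n IH; apply: fU; exists (iter n f b) => //; exact: subset_closure.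
have local v w : L (tproj v) -> ell w = 0 -> `|w| <= d -> L (tproj (v + w)).
  move=> Lv ew wd; rewrite LE => n _; have nN : (n <= n * N)%N by rewrite leq_pmulr.
  exists (iter (n * N - n) f (tproj (iter (n * N) G (v + w)))).
    exact/fUn/stay.
  rewrite -iterD subnKC// (tproj_iterG SL tF).
  by rewrite (cancel_iter _ (@bwdK _ _ f)).
have multi (k : nat) x v : ell x = 0 -> `|x| <= d -> L (tproj v) ->
    L (tproj (v + k%:R *: x)).
  move=> ex xd; elim: k => [|k IH] Lv; first by rewrite scale0r addr0.
  by rewrite -natr1 scalerDl scale1r addrA; apply: local => //; exact: IH.
have line v w : L (tproj v) -> ell w = 0 -> L (tproj (v + w)).
  move=> Lv ew; pose m := (Num.truncn (`|w| / d)).+1.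
  have m0 : 0 < m%:R :> R by rewrite ltr0n.
  have -> : w = m%:R *: (m%:R^-1 *: w) by rewrite scalerKV// gt_eqF.
  have wm : `|m%:R^-1 *: w| <= d.
    rewrite normrZ gtr0_norm ?invr_gt0// mulrC ler_pdivrMr// mulrC -ler_pdivrMr//.
    by rewrite ltW// truncnS_gt.
  have ewm : ell (m%:R^-1 *: w) = 0 by rewrite ellZ ew mulr0.
  exact: multi.
have [M MP] := iter_displacement_bound N.
have half v w : L (tproj v) -> ell w = 0 -> `|iter N G (v + w) - iter N G v| <= 4^-1 * `|w|.
  move=> Lv ew; apply: (leaf_mult_mean_value SL (dG N) (iter_ell_inv SL N) ew).
  move=> s _; have Ls : L (tproj (v + s *: w)).
    by apply: line => //; rewrite ellZ ew mulr0.
  have := leaf_mult_inv SL N (v + s *: w); have := mult4 _ (LGn N _ Ls).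
  have := leaf_mult_ge0 e (iter N G) (v + s *: w).
  by move: (mult _ _) (mult _ _) => a b; nra.
(* The vector is chosen longer than [M]: going [N] steps forward adds at most [M] to its length and
   coming back divides by 4, so it would be shorter than half of itself. *)
pose t : R := M / `|e| + 1.
have ete : ell (t *: e) = 0 by rewrite ellZ (sl_elle SL) mulr0.
have h1 := half (iter N F v0) _ (LFn N _ Lv0) (ell_iterF N v0 ete).
rewrite subrKC !(cancel_iter N (sl_FK SL)) addrAC subrr add0r in h1.
have h2 := MP v0 _ ete.
have : M < `|t *: e|.
  rewrite normrZ (lt_le_trans _ (ler_wpM2r (ltW e_gt0) (ler_norm t)))//.
  by rewrite /t mulrDl divfK ?gt_eqF// mul1r ltrDl.
by have := normr_ge0 (t *: e); lra.
Qed.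

Lemma backward_limit (K L U : set (torus R)) (p : torus R) :
  closed K -> ~ K p ->
  nonwandering f `<=` p |` L -> open U -> L `<=` U -> f @` closure U `<=` U ->
  L = \bigcap_n (iter n f @` U) ->
  forall a, (forall n, K (iter n (bwd f) a)) -> L a.
Proof.
move=> Kc Kp nw Uo LU fU LE a Ka.
have [q [_ qcl]] : exists q, ([set: torus R] `&`
    cluster ((fun n => iter n (bwd f) a) @ \oo)) q.
  apply: torus_compact; first exact: filterT.
have often (V : set (torus R)) m : nbhs q V -> exists2 n, (m <= n)%N & V (iter n (bwd f) a).
  move=> qV.
  have [b [[n mn <-] Vb]] := qcl [set iter n (bwd f) a | n in [set n | (m <= n)%N]] V
    (ltac:(by exists m => // n mn; exists n)) qV.
  by exists n.
have back n m b : iter n f (iter (n + m) (bwd f) b) = iter m (bwd f) b.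
  by rewrite iterD (cancel_iter n (@bwdK _ _ f)).
have Kq : K q.
  apply: Kc => V qV; have [n _ Vn] := often V 0%N qV.
  by exists (iter n (bwd f) a); split.
have [qp|Lq] : ([set p] `|` L) q.
- apply: nw => V Vo Vq.
  have Vn : nbhs q V by exact: open_nbhs_nbhs.
  have [n1 _ V1] := often V 0%N Vn; have [n2 n12 V2] := often V n1.+1 Vn.
  (* The return time is written [n.+1] in [nonwandering]; [n2] was taken beyond [n1] for this. *)
  exists (n2 - n1).-1; rewrite prednK ?subn_gt0//.
  exists (iter n1 (bwd f) a); split=> //; exists (iter n2 (bwd f) a) => //.
  by rewrite -[X in iter X (bwd f)](subnK (ltnW n12)) back.
- by rewrite qp in Kq.
have Un : nbhs q U by apply: open_nbhs_nbhs; split=> //; exact: LU.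
have fUn n b : U b -> U (iter n f b).
  by move=> Ub; elim: n => // n IH; apply: fU; exists (iter n f b) => //; exact: subset_closure.
rewrite LE => n _; have [m nm Um] := often U n Un.
exists (iter (m - n) f (iter m (bwd f) a)); first exact: fUn.
by rewrite -iterD subnKC// -[m in iter m (bwd f)]addn0 back.
Qed.

(** A point with a long backward history in [K] must be near [L]. By compactness: near a point of
    [L] the contraction holds by continuity, and near any other point the backward orbit has left
    [K] at some fixed time. *)
Lemma uniform_contraction (K L : set (torus R)) (B : nat -> R) :
  closed K -> (forall a, K a -> K (f a)) ->
  (forall a, (forall n, K (iter n (bwd f) a)) -> L a) ->
  (forall eps m, 0 < eps -> exists2 n, (m <= n)%N & B n < eps) ->
  (forall v n, L (tproj v) -> mult (iter n F) v <= B n) ->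
  exists N M, (0 < N)%N /\ forall v n, K (tproj v) -> (M <= n)%N ->
    mult (iter N F) (iter n F v) <= 2^-1.
Proof.
move=> Kc fK KL Bsmall contract.
have [N N0 BN] := Bsmall 4^-1 1%N ltac:(by []).
pose P (n : nat) (b : torus R) := forall v, tproj v = b ->
  (forall m, (m <= n)%N -> K (iter m (bwd f) b)) -> mult (iter N F) v <= 2^-1.
have /compact_near_coveringP tc := torus_compact (R := R).
have nearP : \forall n \near \oo, [set: torus R] `<=` P n.
  apply: tc => b _; have [Lb|nLb] := pselect (L b).
    have [v vb] := tproj_surj b; subst b.
    have [d d0 dP] := mult_ball SL N v (ltac:(by []) : (0 : R) < 4^-1).
    have near1 : \forall b \near tproj v, forall x, tproj x = b -> mult (iter N F) x <= 2^-1.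
      apply/near_tproj; exists d => // w wd x /tprojP ix.
      rewrite -(subrKC (v + w) x) (leaf_mult_int SL)// ltW//.
      apply: dist_lt (lt_le_trans (dP _ wd) _).
      by have := contract v N Lb; lra.
    near=> b n => /= x xb _.
    have h : forall x, tproj x = b -> mult (iter N F) x <= 2^-1 by near: b.
    exact: h.
  have [m nKm] : exists m, ~ K (iter m (bwd f) b).
    by apply/existsNP => Kb; exact/nLb/KL.
  have near1 : \forall b' \near b, ~ K (iter m (bwd f) b').
    have cm : {for b, continuous (iter m (bwd f))}.
      elim: m {nKm} => [|m IH]; first exact: cvg_id.
      exact: (@continuous_comp _ _ _ (iter m (bwd f)) (bwd f) b IH (@bwd_continuous _ _ f _)).
    have nK : nbhs (iter m (bwd f) b) (~` K).
      by apply: open_nbhs_nbhs; split=> //; exact: closed_openC.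
    exact: cm nK.
  near=> b' n => /= x xb' /(_ m) Kb'; exfalso.
  have h : ~ K (iter m (bwd f) b') by near: b'.
  by apply/h/Kb'; near: n; exact: nbhs_infty_ge.
have [M _ MP] := nearP.
exists N, M; split=> // v n Kv Mn.
have KF k b : K b -> K (iter k f b) by move=> Kb; elim: k => // k; exact: fK.
apply: (MP M (leqnn M) (tproj (iter n F v))) => // m mM.
have mn : (m <= n)%N by exact: leq_trans Mn.
rewrite (tproj_iterF tF) -(subnKC mn) iterD (cancel_iter m (@fwdK _ _ f)).
exact: KF.
Unshelve. all: by end_near. Qed.

End Contraction.

(** * Orbits of a derived-from-Anosov diffeomorphism *)

Section DerivedFromAnosov.
Variable R : realType.
Local Notation plane := 'rV[R]_2.
Local Notation integral v := (v \is a mxOver Num.int).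

(** [M] is the time an orbit in [K] may need to come near the attractor; from then on blocks of [N]
    steps contract. The set [K] avoids the source, where the stable line of the automorphism is
    expanded. *)
Definition contracting (f : torus R -> torus R) (F : plane -> plane) (e : plane)
    (p : torus R) :=
  forall K : set (torus R), closed K -> ~ K p -> (forall a, K a -> K (f a)) ->
  exists N M, (0 < N)%N /\ forall v n, K (tproj v) -> (M <= n)%N ->
    leaf_mult e (iter N F) (iter n F v) <= 2^-1.

Lemma integral_valued_constant (D : plane -> plane) :
  continuous D -> (forall v, integral (D v)) -> forall v w, D v = D w.
Proof.
move=> cD iD v w; apply/rowP => j.
pose g t := D (w + t *: (v - w)) 0 j.
suff : g 1 = g 0 by rewrite /g scale1r scale0r addr0 subrKC.
apply: (@continuous_countable_range _ _ [set (n%:~R : R) | n in [set: int]]).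
- by apply: sub_countable (card_image_le _ _) _; exact: countableP.
- apply: continuous_subspaceT => t.
  have c1 : {for t, continuous (fun t : R => w + t *: (v - w))}.
    by apply: cvgD; [exact: cvg_cst|apply: cvgZl; exact: cvg_id].
  have c2 : {for t, continuous (D \o (fun t : R => w + t *: (v - w)))}.
    exact: continuous_comp c1 (cD _).
  exact: (@continuous_comp _ _ _ _ (fun M : plane => M 0 j) t c2 (@coord_continuous _ _ _ _ _ _)).
- by move=> t _; have /mxOverP/(_ 0 j)/intrP[n En] := iD (w + t *: (v - w)); exists n.
Qed.

Lemma integral_stable0 (A : 'M[int]_2) (z : plane) :
  A \in unitmx -> integral z -> stable_space A z -> z = 0.
Proof.
move=> Au iz sz.
have inj w : plane_act A w = 0 -> w = 0.
  rewrite /plane_act => /(congr1 (fun x => x *m map_mx intr (invmx A))).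
  by rewrite -mulmxA -map_mxM mulmxV// map_mx1 mulmx1 mul0mx.
have [N _ Nlt] := cvgr_distC_lt (fun n => iter n (plane_act A) z) 0 sz 1 ltr01.
have : iter N (plane_act A) z = 0.
  apply: int_vec_small; last by have := Nlt N (leqnn N); rewrite /= subr0.
  elim: N {Nlt} => // N IH; exact: integral_act.
elim: N {Nlt} => // N IH; rewrite iterS => /inj; exact: IH.
Qed.

Lemma da_stable_lift (A : 'M[int]_2) (f : homeo (torus R) (torus R)) (p : torus R) :
  derived_from_anosov A f p ->
  exists F G e r kap lam, [/\ stable_lift A F G e r kap lam,
    forall v, tproj (F v) = f (tproj v),
    forall w, stable_space A w <-> transverse r w = 0 &
    contracting f F e p].
Proof.
move=> [hypA [F0 [G0 [q [r0 [[tF0 _ _ F0C1 _] _ Fstab _ _]]]]] _].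
move=> [L [nw [Lc fL [F [G [[tF FK GK FC1 GC1] [Es [Eu [C [lh [C0 lh01 split_L]]]]]]]]]]].
move=> [[U [Uo LU fU LE]] [x0 Lx0 dense]] _.
have [e [r [kap [lam [[e0 eA rA kap1 lam1] [ker stab]]]]]] := stable_splitting hypA.
have ellA v : transverse r (plane_act A v) = lam * transverse r v.
  by rewrite /transverse /plane_act -mulmxA rA -scalemxAr mxE.
have F0ell v w : transverse r (F0 v - F0 w) = lam * transverse r (v - w).
  have h1 := proj1 (stab _) (Fstab v); have h2 := proj1 (stab _) (Fstab w).
  rewrite -!/(transverse r _) !ellB ellA in h1 h2.
  by rewrite !ellB; move/subr0_eq: h1 => ->; move/subr0_eq: h2 => ->; rewrite ellA mulrBr.
(* One lift comes with the derived-from-Anosov form, another with the hyperbolic splitting. They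
   differ by a constant, so the transverse law passes from the first to the second. *)
have Dconst v w : F v - F0 v = F w - F0 w.
  apply: (@integral_valued_constant (fun v => F v - F0 v)) => [x|x].
    have c1 : {for x, continuous F}.
      by apply: differentiable_continuous; have [] := FC1.
    have c2 : {for x, continuous F0}.
      by apply: differentiable_continuous; have [] := F0C1.
    exact: (@cvgB _ _ _ (nbhs x) _ F F0 _ _ c1 c2).
  by apply/tprojP; rewrite tF tF0.
have Fell v w : transverse r (F v - F w) = lam * transverse r (v - w).
  rewrite -F0ell; congr (transverse r _).
  by rewrite -[F v](subrK (F0 v)) (Dconst v w); apply/rowP => j; rewrite !mxE; ring.
have SL : stable_lift A F G e r kap lam.
  split=> //.
    have := ellA e; rewrite eA ellZ => /eqP; rewrite -subr_eq0 -mulrBl mulf_eq0.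
    move=> /orP[|/eqP//]; rewrite subr_eq0 => /eqP kl; rewrite kl in kap1.
    by have := lt_trans kap1 lam1; rewrite ltxx.
  (* The defect of equivariance is integral and has no transverse component, hence vanishes. *)
  move=> v k ik; apply/eqP; rewrite -subr_eq0; apply/eqP.
  apply: (integral_stable0 hypA.1).
    rewrite opprD addrA; apply: int_vecB; last exact: integral_act.
    by apply/tprojP; rewrite !tF tprojDint.
  apply/stab; rewrite -/(transverse r _) opprD addrA ellB Fell ellA addrAC subrr add0r.
  by rewrite subrr.
exists F, G, e, r, kap, lam; split=> // K Kc Kp fK.
have [v0 v0x] := tproj_surj x0; subst x0.
have LF v : L (tproj v) -> L (tproj (F v)).
  by move=> Lv; rewrite tF -fL; exists (tproj v).
have lhn : `|lh| < 1 by case/andP: lh01 => l0 l1; rewrite gtr0_norm.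
have small eps m : 0 < eps -> exists2 n, (m <= n)%N & C * lh ^+ n < eps.
  move=> eps0; have [n nP] := geometric_small C lhn eps0.
  exists (n + m)%N; first exact: leq_addl.
  case/andP: lh01 => l0 l1; rewrite gtr0_norm// in nP.
  rewrite (le_lt_trans _ nP)// mulrC ler_pM2r// exprD ler_piMr ?exprn_ge0 ?exprn_ile1//; lra.
have [con|expa] := mult_alternative SL tF C0 lh01 split_L Lx0 LF dense; last first.
  exfalso; apply: (not_expanding SL tF Uo LU fU LE Lc fL Lx0 _ expa) => eps eps0.
  by have [n _ nP] := small eps 0%N eps0; exists n.
apply: (uniform_contraction SL tF Kc fK _ small con).
by apply: (backward_limit Kc Kp _ Uo LU fU LE); rewrite nw.
Qed.

End DerivedFromAnosov.

(** * Pairs of orbits staying close on the torus *)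

Section StableDynamics.
Variable R : realType.
Local Notation plane := 'rV[R]_2.
Local Notation integral v := (v \is a mxOver Num.int).

(** Closeness is expressed by lifts instead of a distance, since the transverse component only makes
    sense for displacements in the plane. *)
Definition near_t (eps : R) (a b : torus R) :=
  exists v w, [/\ tproj v = a, tproj (v + w) = b & `|w| <= eps].

Lemma near_t_eq a b : (forall eps, 0 < eps -> near_t eps a b) -> a = b.
Proof.
move=> near; apply: torus_hausdorff => X Y Xa Yb; exists b; split; last exact: nbhs_singleton.
have [v0 v0a] := tproj_surj a; subst a.
have /near_tproj[d d0 dX] := Xa.
have [v [w [/tprojP iv <- wd]]] := near (d / 2) (divr_gt0 d0 (ltr0n _ 2)).
have -> : tproj (v + w) = tproj (v0 + w).
  by apply/tprojP; rewrite opprD addrACA subrr addr0.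
by apply: dX; rewrite (le_lt_trans wd)//; lra.
Qed.

Lemma near_t_lift eps a b v : near_t eps a b -> tproj v = a ->
  exists2 w, tproj (v + w) = b & `|w| <= eps.
Proof.
move=> [v' [w [v'a <- we]]] va; exists w => //.
by apply/tprojP; rewrite opprD addrACA subrr addr0; apply/tprojP; rewrite va v'a.
Qed.

Variables (f : homeo (torus R) (torus R)).
Variables (A : 'M[int]_2) (F G : plane -> plane) (e : plane).
Variables (r : 'cV[R]_2) (kap lam : R) (p : torus R).
Hypothesis SL : stable_lift A F G e r kap lam.
Hypothesis tF : forall v, tproj (F v) = f (tproj v).
Hypothesis con : contracting f F e p.
Local Notation ell := (transverse r).
Local Notation mult := (leaf_mult e).

Let dF n v : differentiable (iter n F) v.
Proof. by apply: differentiable_iter => x; have [] := sl_FC1 SL. Qed.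

(* The displacement transverse to the stable foliation grows like [lam ^+ n]. *)
Lemma forward_close_leaf : exists2 eps0 : R, 0 < eps0 & forall eps, eps <= eps0 ->
  forall a b, (forall n, near_t eps (iter n f a) (iter n f b)) ->
  exists v w, [/\ tproj v = a, tproj (v + w) = b, ell w = 0 &
    forall n, `|iter n F (v + w) - iter n F v| <= eps].
Proof.
have [d d0 dP] := iterF_uniform SL 1 (ltac:(by []) : (0 : R) < 4^-1).
exists (Num.min d 4^-1) => [|eps]; first by rewrite lt_min d0 /=.
rewrite le_min => /andP[epsd eps4] a b near.
have [v va] := tproj_surj a.
have [w wb we] := near_t_lift (near 0%N) va.
have bound n : `|iter n F (v + w) - iter n F v| <= eps.
  elim: n => [|n IH]; first by rewrite /= addrAC subrr add0r.
  have vn : tproj (iter n.+1 F v) = iter n.+1 f a by rewrite (tproj_iterF tF) va.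
  have [w' w'b w'e] := near_t_lift (near n.+1) vn.
  have step : `|iter n.+1 F (v + w) - iter n.+1 F v| <= 4^-1.
    have := dP (iter n F v) _ (le_trans IH epsd); rewrite subrKC; exact.
  (* The image of the previous displacement and the small one given by closeness lift the same pair
     of points; both have norm at most 1/4, so they agree. *)
  suff : iter n.+1 F (v + w) - iter n.+1 F v - w' = 0 by move/subr0_eq => ->.
  apply: int_vec_small.
    rewrite -addrA -opprD; apply/tprojP.
    by rewrite w'b (tproj_iterF tF) wb.
  by rewrite (le_lt_trans (ler_normB _ _))//; lra.
exists v, w; split=> //.
have [M M0 rM] := ell_bound r.
apply: (expansion_bounded (sl_lam SL) (B := M * eps)) => n.
rewrite -[w in ell w](addKr v) addrC -(iter_ell SL) (le_trans (rM _))//.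
by rewrite ler_pM2l.
Qed.

(** Closeness is used from [k * N] steps in the past: there the displacement is a stable vector of
    size at most [eps], and [k] contracting blocks reduce it to [(3 / 4) ^+ k * eps] at time zero,
    with [k] arbitrary. *)
Lemma invariant_expansive (K : set (torus R)) : closed K -> ~ K p ->
  (forall a, K a -> K (f a)) -> (forall a, K a -> K (bwd f a)) ->
  exists2 eps : R, 0 < eps & forall a b, K a ->
    (forall n, near_t eps (iter n f a) (iter n f b)) ->
    (forall n, near_t eps (iter n (bwd f) a) (iter n (bwd f) b)) -> a = b.
Proof.
move=> Kc Kp fK bK; have [N [M [N0 NP]]] := con Kc Kp fK.
have KF n v : K (tproj v) -> K (tproj (iter n F v)).
  by move=> Kv; elim: n => // n IH; rewrite iterS tF; exact: fK.
have bKn n a : K a -> K (iter n (bwd f) a).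
  by move=> Ka; elim: n => // n; exact: bK.
(* Backward invariance removes the waiting time: every point of [K] is the [M]-th image of a point
   of [K]. *)
have multK v : K (tproj v) -> mult (iter N F) v <= 2^-1.
  move=> Kv; rewrite -[v](cancel_iter M (sl_GK SL)); apply: NP => //.
  by rewrite (tproj_iterG SL tF); exact: bKn.
have Kcp : compact K by apply: (subclosed_compact Kc (@torus_compact R)).
(* The segment from [a] to [b] may leave [K]; 3/4 instead of 1/2 leaves room for it. *)
have [d d0 dP] : exists2 d : R, 0 < d & forall v w, K (tproj v) -> `|w| <= d ->
    mult (iter N F) (v + w) <= 3 / 4.
  apply: (torus_lebesgue (Q := fun _ w => mult (iter N F) w <= 3 / 4) Kcp).
    by move=> _ w k ik; rewrite (leaf_mult_int SL).
  move=> v Kv.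
  have [d d0 dP] := mult_ball SL N v (ltac:(by []) : (0 : R) < 4^-1).
  exists d => // _ w' _ /dP; rewrite subrKC => h; apply/ltW/(dist_lt (lt_le_trans h _)).
  by have := multK v Kv; lra.
have [eps0 eps00 epsP] := forward_close_leaf.
exists (Num.min eps0 d) => [|a b Ka fwdc bwdc]; first by rewrite lt_min eps00.
apply: near_t_eq => eta eta0.
set eps := Num.min eps0 d in fwdc bwdc *.
have [k kP] : exists k, `|3 / 4 : R| ^+ k * eps < eta.
  by apply: geometric_small => //; rewrite ger0_norm; lra.
have {}kP : (3 / 4) ^+ k * eps < eta by rewrite ger0_norm in kP; [exact: kP|lra].
have near n : near_t eps (iter n f (iter (k * N) (bwd f) a))
    (iter n f (iter (k * N) (bwd f) b)).
  have [nk|/ltnW kn] := leqP n (k * N).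
    have := bwdc (k * N - n)%N; rewrite -{3 4}(subnKC nk) !iterD.
    by rewrite !(cancel_iter n (@bwdK _ _ f)).
  have := fwdc (n - k * N)%N; rewrite -{3 4}(subnK kn) !iterD.
  by rewrite !(cancel_iter _ (@bwdK _ _ f)).
have [v [w [va wb ew wn]]] := epsP eps ltac:(by rewrite ge_min lexx) _ _ near.
have Kv : K (tproj v) by rewrite va; exact: bKn.
have shrink j : `|iter (j * N) F (v + w) - iter (j * N) F v| <= (3 / 4) ^+ j * eps.
  elim: j => [|j IH]; first by rewrite mul1r (wn 0%N).
  rewrite mulSn !iterD -[iter (j * N) F (v + w)](subrKC (iter (j * N) F v)).
  apply: (le_trans (leaf_mult_mean_value SL (B := 3 / 4) (dF N) (iter_ell SL N) _ _)).
  - exact: (ell_iterF SL).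
  - move=> s /andP[s0 s1]; apply: dP; first exact: KF.
    rewrite normrZ ger0_norm// (le_trans _ (_ : eps <= d))//; last by rewrite ge_min lexx orbT.
    by apply: le_trans (wn (j * N)%N); exact: ler_piMl.
  - by rewrite exprS -mulrA ler_wpM2l//; lra.
exists (iter (k * N) F v), (iter (k * N) F (v + w) - iter (k * N) F v); split.
- by rewrite (tproj_iterF tF) va (cancel_iter _ (@bwdK _ _ f)).
- by rewrite subrKC (tproj_iterF tF) wb (cancel_iter _ (@bwdK _ _ f)).
- by rewrite (le_trans (shrink k))// ltW.
Qed.

(** The waiting time and an incomplete block cost at most [B ^+ (N + M)] and complete blocks
    contract, so the multiplier is bounded for all times at once. Segments starting in [K] may leave
    it; the open set [O] guarantees that short ones stay in [K']. *)
Lemma leaf_stable (K O K' : set (torus R)) : closed K -> open O -> K `<=` O ->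
  O `<=` K' -> closed K' -> ~ K' p -> (forall a, K' a -> K' (f a)) ->
  forall eps : R, 0 < eps -> exists2 d : R, 0 < d & forall v w, K (tproj v) ->
    ell w = 0 -> `|w| <= d -> forall n, `|iter n F (v + w) - iter n F v| <= eps.
Proof.
move=> Kc Oo KO OK' Kc' Kp' fK' eps eps0; have [N [M [N0 NP]]] := con Kc' Kp' fK'.
have [B0 B0P] : exists B0, forall v, mult (iter 1 F) v <= B0.
  apply: periodic_bounded; first exact: (leaf_mult_continuous SL (n := 1)).
  by move=> v k; exact: (leaf_mult_int SL).
pose B := Num.max B0 1.
have B1 : 1 <= B by rewrite le_max lexx orbT.
have BP v : mult (iter 1 F) v <= B by rewrite le_max B0P.
have BnP n v : mult (iter n F) v <= B ^+ n.
  elim: n v => [|n IH] v; first by rewrite (leaf_mult0 SL).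
  have := leaf_multD SL n 1 v; rewrite addn1 => ->.
  by rewrite exprSr ler_pM ?leaf_mult_ge0.
have C1 v n : K' (tproj v) -> mult (iter n F) v <= B ^+ (N + M).
  move=> Kv; have [nM|/ltnW Mn] := leqP n M.
    by rewrite (le_trans (BnP _ _))// ler_weXn2l// (leq_trans nM)// leq_addl.
  have block q : mult (iter (q * N + M) F) v <= B ^+ M.
    elim: q => [|q IH]; first exact: BnP.
    rewrite mulSn -addnA (leaf_multD SL) -[leRHS]mul1r ler_pM ?leaf_mult_ge0//.
    by apply: (le_trans (NP _ _ Kv _)); [exact: leq_addl|lra].
  rewrite -(subnK Mn) (divn_eq (n - M) N) addnAC addnC (leaf_multD SL) exprD.
  rewrite ler_pM ?leaf_mult_ge0// (le_trans (BnP _ _))// ler_weXn2l//.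
  by rewrite ltnW// ltn_mod.
have Kcp : compact K by apply: (subclosed_compact Kc (@torus_compact R)).
have [d d0 dP] : exists2 d : R, 0 < d & forall v w, K (tproj v) -> `|w| <= d ->
    K' (tproj (v + w)).
  apply: (torus_lebesgue (Q := fun _ w => K' (tproj w)) Kcp).
    by move=> _ w k ik; rewrite tprojDint.
  move=> v Kv.
  have [d d0 dP] : exists2 d : R, 0 < d & forall w, `|w| < d -> O (tproj (v + w)).
    by apply/near_tproj; apply: open_nbhs_nbhs; split=> //; exact: KO.
  by exists d => // _ w' _ /dP; rewrite subrKC => /OK'.
have BNM : 0 < B ^+ (N + M) by rewrite exprn_gt0// (lt_le_trans ltr01).
exists (Num.min d (eps / B ^+ (N + M))).
  by rewrite lt_min d0 divr_gt0.
move=> v w Kv ew; rewrite le_min => /andP[wd weps] n.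
apply: (le_trans (leaf_mult_mean_value SL (B := B ^+ (N + M)) (dF n) (iter_ell SL n) ew _)).
  move=> s /andP[s0 s1]; apply/C1/dP => //.
  by rewrite normrZ ger0_norm// (le_trans _ wd)// ler_piMl.
by rewrite mulrC -ler_pdivlMr.
Qed.

End StableDynamics.

(** * Charts at the source *)

Section Discs.
Variable R : realType.
Local Notation plane := 'rV[R]_2.

Lemma sum2E (v : plane) : \sum_j v 0 j ^+ 2 = v 0 0 ^+ 2 + v 0 1 ^+ 2.
Proof.
rewrite big_ord_recl big_ord1; congr (v 0 _ ^+ 2 + v 0 _ ^+ 2); exact/val_inj.
Qed.

Lemma enorm_le (v : plane) c : 0 <= c -> (enorm v <= c) = (v 0 0 ^+ 2 + v 0 1 ^+ 2 <= c ^+ 2).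
Proof.
move=> c0; rewrite /enorm sum2E -[c in LHS]ger0_norm// -sqrtr_sqr ler_sqrt//.
exact: sqr_ge0.
Qed.

Lemma enorm_lt (v : plane) c : 0 < c -> (enorm v < c) = (v 0 0 ^+ 2 + v 0 1 ^+ 2 < c ^+ 2).
Proof.
move=> c0; rewrite /enorm sum2E -[c in LHS]gtr0_norm// -sqrtr_sqr ltr_sqrt//.
by rewrite exprn_gt0.
Qed.

Lemma enorm_scale (c : R) v : 0 <= c -> enorm (c *: v) = c * enorm v.
Proof. by move=> c0; rewrite enormZ ger0_norm. Qed.

Lemma norm_le_enorm (v : plane) : `|v| <= enorm v.
Proof. by apply: norm_le_coord => [|j]; [exact: enorm_ge0|exact: enorm_coord]. Qed.

Lemma enorm_continuous : continuous (@enorm R).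
Proof.
move=> v; have -> : @enorm R = Num.sqrt \o (fun v => v 0 0 ^+ 2 + v 0 1 ^+ 2).
  by apply/funext => x; rewrite /enorm sum2E.
apply: continuous_comp; last exact: sqrt_continuous.
have c j : {for v, continuous (fun v : plane => v 0 j)} by exact: coord_continuous.
have c2 i : {for v, continuous (fun v : plane => v 0 i ^+ 2)} by exact: cvgM (c i) (c i).
exact: cvgD (c2 0) (c2 1).
Qed.

Lemma closed_disc c : closed [set v : plane | enorm v <= c].
Proof.
have -> : [set v : plane | enorm v <= c] = @enorm R @^-1` [set x | x <= c] by [].
by apply: closed_comp => [v _|]; [exact: enorm_continuous|exact: closed_le].
Qed.

Lemma compact_disc c : compact [set v : plane | enorm v <= c].
Proof.
apply: bounded_closed_compact; last exact: closed_disc.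
exists c; split; first exact: num_real.
by move=> M cM v /= vc; apply: le_trans (norm_le_enorm _) (le_trans vc (ltW cM)).
Qed.

Lemma disc_segment (u u' : plane) s : disc u -> disc u' -> 0 <= s <= 1 ->
  disc (u + s *: (u' - u)).
Proof.
rewrite /disc /= !enorm_le// !mxE => h h' /andP[s0 s1].
set a := u 0 0 in h *; set b := u 0 1 in h *.
set a' := u' 0 0 in h' *; set b' := u' 0 1 in h' *.
have cvx x y : (x + s * (y - x)) ^+ 2 <= (1 - s) * x ^+ 2 + s * y ^+ 2.
  have : 0 <= s * (1 - s) * (x - y) ^+ 2.
    by rewrite mulr_ge0 ?sqr_ge0// mulr_ge0// subr_ge0.
  rewrite -subr_ge0 => k; rewrite -subr_ge0; apply: le_trans k _.
  by rewrite le_eqVlt; apply/orP; left; apply/eqP; ring.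
by have := cvx a a'; have := cvx b b'; nra.
Qed.

End Discs.

Section Chart.
Variable R : realType.
Local Notation plane := 'rV[R]_2.
Local Notation integral v := (v \is a mxOver Num.int).
Variables (f : homeo (torus R) (torus R)).
Variables (A : 'M[int]_2) (F G : plane -> plane) (e : plane).
Variables (r : 'cV[R]_2) (kap lam : R) (p : torus R).
Hypothesis SL : stable_lift A F G e r kap lam.
Hypothesis tF : forall v, tproj (F v) = f (tproj v).
Hypothesis stab : forall w, stable_space A w <-> transverse r w = 0.
Hypothesis con : contracting f F e p.
Variables (phi : plane -> torus R) (j : 'I_2).
Hypothesis phi_chart : local_chart phi.
Hypothesis phi0 : phi 0 = p.
Hypothesis phi_f : forall v, disc v -> bwd f (phi v) = phi (4^-1 *: v).
Hypothesis phi_leaf : forall v, disc v ->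
  pullback_leaf phi (stable_leaf A) v = @disc R `&` [set w | w 0 j = v 0 j].
Local Notation ell := (transverse r).

Let phi_inj u u' : disc u -> disc u' -> phi u = phi u' -> u = u'.
Proof. by have [_ inj _] := phi_chart; move=> du du'; apply: inj; rewrite inE. Qed.

Definition chart_image : set (torus R) := phi @` @open_disc R.
Local Notation U := chart_image.

Lemma chart_image_open : open U. Proof. by have [] := phi_chart. Qed.

Lemma disc_quarter (v : plane) : disc v -> disc (4^-1 *: v).
Proof. by rewrite /disc /= enorm_scale => [|//] dv; have := enorm_ge0 v; lra. Qed.

Lemma open_discW (v : plane) : open_disc v -> disc v. Proof. exact: ltW. Qed.

Lemma holeW (v : plane) : hole v -> disc v.
Proof. by rewrite /hole /disc /= => ?; lra. Qed.

(** In the chart [f] is multiplication by 4, which takes the radius of the hole to that of the disc.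
    This writes the complement of the hole as a preimage under [f]. *)
Lemma hole_imageE a : (phi @` @hole R) a <-> U (f a).
Proof.
split=> [[v hv <-]|[v ov va]].
  have d4 : open_disc (4 *: v) by move: hv; rewrite /hole /open_disc /= enorm_scale//; lra.
  exists (4 *: v) => //; rewrite -[phi (4 *: v)](@bwdK _ _ f); congr (fwd f _).
  by rewrite phi_f ?scalerK//; exact: open_discW.
exists (4^-1 *: v); first by move: ov; rewrite /hole /open_disc /= enorm_scale//; lra.
by rewrite -phi_f; [rewrite va fwdK|exact: open_discW].
Qed.

Lemma chart_image_bwd b : U b -> U (bwd f b).
Proof.
move=> [v ov <-]; rewrite phi_f; last exact: open_discW.
exists (4^-1 *: v) => //.
by move: ov; rewrite /open_disc /= enorm_scale// => ov; have := enorm_ge0 v; lra.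
Qed.

Lemma chart_image_f b : U (f b) -> U b.
Proof. by move/chart_image_bwd; rewrite fwdK. Qed.

Lemma f_fix : f p = p.
Proof.
rewrite -[RHS](@bwdK _ _ f); congr (fwd f _); rewrite -phi0 phi_f ?scaler0//.
by rewrite /disc /= enorm_le// !mxE; lra.
Qed.

Lemma chart_image_p : U p.
Proof. by exists 0 => //; rewrite /open_disc /= enorm_lt// !mxE; lra. Qed.

Lemma chart_within u V : disc u -> nbhs (phi u) V ->
  exists2 d : R, 0 < d & forall u', disc u' -> `|u' - u| < d -> V (phi u').
Proof.
move=> du Vu; have [/subspace_continuousP cphi _ _] := phi_chart.
have : nbhs u [set u' | disc u' -> V (phi u')] by exact: (cphi u du _ Vu).
move=> /nbhs_rV[d d0 dP]; exists d => // u' du' ud.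
by have := dP _ ud; rewrite /= subrKC; exact.
Qed.

Lemma chart_compact (C : set plane) : compact C -> C `<=` @disc R -> compact (phi @` C).
Proof.
move=> Cc CD; apply: continuous_compact => //.
by have [+ _ _] := phi_chart; exact: continuous_subspaceW.
Qed.

(** A continuous injection of a compact set into a Hausdorff space has a continuous inverse. *)
Lemma chart_inverse u eps : disc u -> 0 < eps ->
  \forall b \near phi u, forall u', disc u' -> phi u' = b -> `|u' - u| < eps.
Proof.
move=> du eps0.
pose C := [set v : plane | enorm v <= 2] `&` [set v | eps <= `|v - u|].
have Cc : compact C.
  apply: (@subclosed_compact _ C [set v : plane | enorm v <= 2]) => [||v []//].
    apply: closedI; first exact: (@closed_disc R 2).
    have -> : [set v : plane | eps <= `|v - u|] = (fun v => `|v - u|) @^-1` [set x | eps <= x] by [].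
    apply: closed_comp => [v _|]; last exact: closed_ge.
    have c : {for v, continuous (fun v : plane => v - u)}.
      have c1 : {for v, continuous (fun v : plane => v)} by exact: cvg_id.
      have c2 : {for v, continuous (fun _ : plane => u)} by exact: cst_continuous.
      exact: (@cvgB _ _ _ (nbhs v) _ _ _ _ _ c1 c2).
    exact: (@cvg_norm _ _ _ (nbhs v) _ _ _ c).
  exact: (@compact_disc R 2).
have imc : closed (phi @` C).
  by apply: compact_closed (chart_compact Cc _); [exact: torus_hausdorff|move=> v []].
have : nbhs (phi u) (~` (phi @` C)).
  apply: open_nbhs_nbhs; split; first exact: closed_openC.
  move=> [v [dv /=]] + vu; rewrite (phi_inj dv du vu) subrr normr0; lra.
apply: filterS => b nb u' du' u'b; rewrite ltNge; apply/negP => le.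
by apply: nb; exists u'.
Qed.

Lemma chart_uniform eps : 0 < eps -> exists2 d : R, 0 < d &
  forall u u', disc u -> disc u' -> `|u' - u| <= d -> near_t eps (phi u) (phi u').
Proof.
move=> eps0.
pose P (d : R) (u : plane) := disc u -> forall u', disc u' -> `|u' - u| <= d ->
  near_t eps (phi u) (phi u').
have /compact_near_coveringP dc := @compact_disc R 2.
have nearP : \forall d \near 0^'+, [set v : plane | enorm v <= 2] `<=` P d.
  apply: dc => u du; have [v vu] := tproj_surj (phi u).
  have Vu : nbhs (phi u) [set b | exists2 w, `|w| < eps / 2 & tproj (v + w) = b].
    by rewrite -vu; apply/near_tproj; exists (eps / 2) => [|w we]; [rewrite divr_gt0|exists w].
  have [d d0 dP] := chart_within du Vu.
  have near1 : \forall x \near u, `|x - u| < d / 2.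
    apply/nbhs_rV; exists (d / 2) => [|w]; first by rewrite divr_gt0.
    by rewrite addrAC subrr add0r.
  have near2 : \forall d' \near 0^'+, d' < d / 2 by apply: nbhs_right_lt; rewrite divr_gt0.
  near=> x d' => /= dx u' du' u'x.
  have xd : `|x - u| < d / 2 by near: x.
  have d'd : d' < d / 2 by near: d'.
  have [w we wx] := dP x dx ltac:(lra).
  have [w' we' wx'] : exists2 w', `|w'| < eps / 2 & tproj (v + w') = phi u'.
    apply: dP => //; rewrite -(subrKA x) (le_lt_trans (ler_normD _ _))//; lra.
  exists (v + w), (w' - w); split=> //; first by rewrite addrA addrAC addrK.
  by rewrite (le_trans (ler_normB _ _))//; lra.
have [d d0 dP] := near_right_ex nearP; exists d => // u u' du; exact: dP.
Unshelve. all: by end_near. Qed.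

Let int_pair (m : int * int) : plane := \row_i (if i == 0 then m.1 else m.2)%:~R.

Let ell_int_countable : countable [set ell k | k in [set k | integral k]].
Proof.
apply: (@sub_countable _ _ _ [set ell (int_pair m) | m in [set: int * int]]).
  apply: subset_card_le => _ [k /mxOverP ik <-].
  have /intrP[m0 m0E] := ik 0 0; have /intrP[m1 m1E] := ik 0 1.
  by exists (m0, m1) => //; congr (ell _); apply: rV2P; rewrite mxE.
by apply: sub_countable (card_image_le _ _) _; exact: countableP.
Qed.

(* The displacement along a short segment of a leaf of the chart has its
   [ell]-component in a countable set, hence zero. *)
Lemma chart_segment_leaf eps : 0 < eps -> exists2 d : R, 0 < d &
  forall u u', disc u -> disc u' -> u' 0 j = u 0 j -> `|u' - u| <= d ->
  exists v w, [/\ tproj v = phi u, tproj (v + w) = phi u', ell w = 0 & `|w| <= eps].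
Proof.
move=> eps0; pose eta := Num.min eps 4^-1.
have eta0 : 0 < eta by rewrite lt_min eps0 /=.
have eta4 : eta <= 4^-1 by rewrite ge_min lexx orbT.
have [d d0 dP] := chart_uniform eta0; exists d => // u u' du du' uj ud.
pose us s := u + s *: (u' - u).
have dus s : 0 <= s <= 1 -> disc (us s) by exact: disc_segment.
have [v vu] := tproj_surj (phi u).
have ex s : exists w, 0 <= s <= 1 -> tproj (v + w) = phi (us s) /\ `|w| <= eta.
  have [s01|?] := pselect (0 <= s <= 1); last by exists 0.
  have near : near_t eta (phi u) (phi (us s)).
    apply: dP => //; first exact: dus.
    rewrite /us addrAC subrr add0r normrZ (le_trans _ ud)//.
    by case/andP: s01 => s0 s1; rewrite ger0_norm// ler_piMl.
  by have [w wu we] := near_t_lift near vu; exists w.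
(* The lifts are chosen pointwise; having norm at most 1/4 they are unique, and their continuity
   along the segment follows from this. *)
have [W WP] := choice ex.
have W0 : W 0 = 0.
  have [W0e W0s] := WP 0 ltac:(by rewrite lexx ler01).
  apply: int_vec_small; last by rewrite (le_lt_trans W0s)//; lra.
  by rewrite -(addKr v (W 0)) addrC; apply/tprojP; rewrite W0e vu /us scale0r addr0.
have [W1e W1s] := WP 1 ltac:(by rewrite lexx ler01).
exists v, (W 1); split=> //; first by rewrite W1e /us scale1r subrKC.
  have -> : 0 = ell (W 0) by rewrite W0 /transverse mul0mx mxE.
  apply: (continuous_countable_range ell_int_countable (g := ell \o W)).
    apply/subspace_continuousP => s0 /=; rewrite in_itv /= => s01.
    have [M M0 rM] := ell_bound r.
    apply/cvgrPdist_lt => a a0.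
    pose b := Num.min (a / M / 2) 4^-1.
    have b0 : 0 < b by rewrite lt_min; apply/andP; split; rewrite ?divr_gt0.
    have b4 : b <= 4^-1 by rewrite ge_min lexx orbT.
    have [c c0 cP] := chart_uniform b0.
    rewrite near_withinE; apply/nbhs_ballP; exists (c / (`|u' - u| + 1)) => [|s].
      by rewrite /= divr_gt0// ltr_wpDl.
    rewrite /ball /= => ss; rewrite in_itv /= => sI.
    have near : near_t b (phi (us s0)) (phi (us s)).
      apply: cP; [exact: dus|exact: dus|].
      rewrite /us opprD addrACA subrr add0r -scalerBl normrZ distrC.
      rewrite ltr_pdivlMr ?ltr_wpDl// in ss; apply: le_trans (ltW ss).
      by rewrite ler_wpM2l// lerDl.
    have [Ws Wsn] := WP s sI; have [Ws0 Ws0n] := WP s0 s01.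
    have [z zs zb] := near_t_lift near Ws0.
    have Wz : W s - W s0 - z = 0.
      apply: int_vec_small.
        have -> : W s - W s0 - z = (v + W s) - (v + W s0 + z).
          by apply/rowP => i; rewrite !mxE; ring.
        by apply/tprojP; rewrite Ws zs.
      rewrite (le_lt_trans (ler_normB _ _))//.
      by have := ler_normB (W s) (W s0); lra.
    suff : `|ell (W s0) - ell (W s)| < a by [].
    rewrite -normrN opprB -ellB; move/subr0_eq: Wz => ->.
    rewrite (le_lt_trans (rM _))//.
    have zb2 : `|z| <= a / M / 2 by rewrite (le_trans zb)// ge_min lexx.
    rewrite mulrC -ltr_pdivlMr// (le_lt_trans zb2)//.
    by have := divr_gt0 a0 M0; lra.
  move=> s s01 /=; have [Ws _] := WP s s01.
  have : pullback_leaf phi (stable_leaf A) u (us s).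
    rewrite phi_leaf//; split; first exact: dus.
    by rewrite /= !mxE uj subrr mulr0 addr0.
  move=> /connected_component_sub[_ [v' [w' [v'u /stab ew' us_s]]]].
  (* A leaf returns to the chart, so [W s] agrees with the stable vector [w'] only up to this
     lattice vector. *)
  exists (v + W s - (v' + w') + (v' - v)).
    apply: int_vecD; apply/tprojP; first by rewrite Ws us_s.
    by rewrite v'u vu.
  rewrite -[RHS]subr0 -ew' -ellB; congr (ell _).
  by apply/rowP => i; rewrite !mxE; ring.
by rewrite (le_trans W1s)// ge_min lexx.
Qed.

(** A short straight stable segment projects into the chart and pulls back to a connected set inside
    the preimage of one leaf, hence to one coordinate line. The radius 1/2 keeps the starting points
    in a compact part of the open disc. *)
Lemma leaf_in_chart : exists2 eps : R, 0 < eps & forall u, enorm u <= 2^-1 ->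
  forall v w, tproj v = phi u -> ell w = 0 -> `|w| <= eps ->
  exists u', [/\ disc u', phi u' = tproj (v + w) & u' 0 j = u 0 j].
Proof.
have small_disc (u : plane) : enorm u <= 2^-1 -> disc u by rewrite /disc /=; lra.
have Kc : compact (phi @` [set v : plane | enorm v <= 2^-1]).
  by apply: chart_compact; [exact: (@compact_disc R _)|exact: small_disc].
have [d d0 dP] : exists2 d : R, 0 < d & forall v w,
    (phi @` [set v : plane | enorm v <= 2^-1]) (tproj v) -> `|w| <= d ->
    U (tproj (v + w)).
  apply: (torus_lebesgue (Q := fun _ w => U (tproj w)) Kc).
    by move=> _ w k ik; rewrite tprojDint.
  move=> v [u us uv].
  have [d d0 dP] : exists2 d : R, 0 < d & forall w, `|w| < d -> U (tproj (v + w)).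
    apply/near_tproj; apply: open_nbhs_nbhs; split; first exact: chart_image_open.
    rewrite -uv; exists u => //; by rewrite /open_disc /=; move: us => /=; lra.
  by exists d => // _ w' _ /dP; rewrite subrKC.
exists d => // u us v w vu ew wd; have du := small_disc u us.
have ex s : exists x, 0 <= s <= 1 -> disc x /\ phi x = tproj (v + s *: w).
  have [/andP[s0 s1]|?] := pselect (0 <= s <= 1); last by exists 0.
  have [x ox xE] : U (tproj (v + s *: w)).
    apply: dP; first by exists u.
    by rewrite normrZ ger0_norm// (le_trans _ wd)// ler_piMl.
  by exists x => _; split=> //; exact: open_discW.
have [x xP] := choice ex.
have x0 : x 0 = u.
  have [dx xE] := xP 0 ltac:(by rewrite lexx ler01).
  by apply: phi_inj => //; rewrite xE scale0r addr0.
have [dx1 x1E] := xP 1 ltac:(by rewrite lexx ler01).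
exists (x 1); split=> //; first by rewrite x1E scale1r.
suff : pullback_leaf phi (stable_leaf A) u (x 1) by rewrite phi_leaf// => -[].
pose C := x @` `[0, 1]%classic.
suff sub : C `<=` pullback_leaf phi (stable_leaf A) u.
  by apply: sub; exists 1 => //; rewrite /= in_itv /= lexx ler01.
apply: connected_component_max.
- by exists 0 => //; rewrite /= in_itv /= lexx ler01.
- move=> y [s /=]; rewrite in_itv /= => s01 <- {y}; have [dx xE] := xP s s01.
  split=> //=; exists v, (s *: w); split=> //.
  by apply/stab; rewrite ellZ ew mulr0.
- apply: connected_continuous_connected; first exact: segment_connected.
  apply/subspace_continuousP => s0 /=; rewrite in_itv /= => s01.
  apply: (proj2 (@cvgrPdist_lt _ plane _ (within _ (nbhs s0)) _ x (x s0))) => a a0.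
  have [dx0 x0E] := xP s0 s01.
  have := chart_inverse dx0 a0; rewrite x0E => /near_tproj[c c0 cP].
  rewrite near_withinE; apply/nbhs_ballP; exists (c / (`|w| + 1)) => [|s].
    by rewrite /= divr_gt0// ltr_wpDl.
  rewrite /ball /= => ss; rewrite in_itv /= => sI; have [dx xE] := xP s sI.
  rewrite distrC; apply: (cP ((s - s0) *: w)) => //.
    rewrite normrZ distrC; rewrite ltr_pdivlMr ?ltr_wpDl// in ss.
    by apply: le_lt_trans ss; rewrite ler_wpM2l// lerDl.
  by rewrite xE -addrA -scalerDl subrKC.
Qed.

Definition outside : set (torus R) := ~` (phi @` @hole R).

Lemma preimage_f_closed (K : set (torus R)) : closed K -> closed (f @^-1` K).
Proof. by move=> Kc; apply: closed_comp => // a _; exact: fwd_continuous. Qed.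

Lemma outsideE : outside = f @^-1` (~` U).
Proof. by apply/seteqP; split=> a /= na h; apply: na; apply/hole_imageE. Qed.

Lemma outside_closed : closed outside.
Proof. by rewrite outsideE; exact: (preimage_f_closed (open_closedC chart_image_open)). Qed.

Lemma outside_f a : outside a -> outside (f a).
Proof. by rewrite outsideE /= => na h; exact/na/chart_image_f. Qed.

Lemma annulus_disc (u : plane) : annulus u -> disc u.
Proof. by case/andP. Qed.

Lemma annulus_outside u : annulus u -> outside (phi u).
Proof.
move=> /[dup] /annulus_disc du /andP[u2 _] [v hv vu].
by have := hv; rewrite /hole /= (phi_inj (holeW hv) du vu) ltNge u2.
Qed.

Lemma chart_leaf_stable eps : 0 < eps -> exists2 d : R, 0 < d &
  forall u u', annulus u -> annulus u' -> u' 0 j = u 0 j -> `|u' - u| <= d ->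
  forall n, near_t eps (iter n f (phi u)) (iter n f (phi u')).
Proof.
move=> eps0; pose K' := f @^-1` outside.
(* [outside], [O] and [K'] are the complements of chart discs of radius 1/2, 1/4 and 1/8, the last
   because [f] multiplies by 4. *)
pose O := ~` (phi @` [set v : plane | enorm v <= 4^-1]).
have [d d0 dP] : exists2 d : R, 0 < d & forall v w, outside (tproj v) ->
    ell w = 0 -> `|w| <= d -> forall n, `|iter n F (v + w) - iter n F v| <= eps.
  refine (leaf_stable SL con (K := outside) (O := O) (K' := K') _ _ _ _ _ _ _ eps0).
  - exact: outside_closed.
  - apply: closed_openC; apply: compact_closed; first exact: torus_hausdorff.
    by apply: chart_compact; [exact: (@compact_disc R _)|move=> v; rewrite /disc /=; lra].
  - move=> a oa [v va vE]; apply: oa; exists v => //.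
    by move: va; rewrite /hole /=; lra.
  - move=> a na; rewrite /K' outsideE /= => -[v ov va]; apply: na.
    exists (4^-1 *: (4^-1 *: v)).
      by move: ov; rewrite /open_disc /= !enorm_scale//; lra.
    rewrite -!phi_f; [|exact: open_discW|exact/disc_quarter/open_discW].
    by rewrite va !fwdK.
  - by apply: preimage_f_closed; exact: outside_closed.
  - rewrite /K' /= outsideE /= !f_fix => np; exact/np/chart_image_p.
  - by move=> a; exact: outside_f.
have [c c0 cP] := chart_segment_leaf d0.
exists c => // u u' au au' uj uc n.
have [v [w [vu wu ew wd]]] := cP _ _ (annulus_disc au) (annulus_disc au') uj uc.
exists (iter n F v), (iter n F (v + w) - iter n F v); split.
- by rewrite (tproj_iterF tF) vu.
- by rewrite subrKC (tproj_iterF tF) wu.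
- by apply: dP => //; rewrite vu; exact: annulus_outside.
Qed.

(** A closed set, invariant in both directions and without the source, so that [invariant_expansive]
    applies. *)
Definition unreached : set (torus R) := [set a | forall n, ~ U (iter n (bwd f) a)].

Lemma unreached_expansive : exists2 eps : R, 0 < eps & forall a b, unreached a ->
    (forall n, near_t eps (iter n f a) (iter n f b)) ->
    (forall n, near_t eps (iter n (bwd f) a) (iter n (bwd f) b)) -> a = b.
Proof.
apply: (invariant_expansive SL tF con).
- have -> : unreached = \bigcap_n (iter n (bwd f) @^-1` (~` U)).
    by apply/seteqP; split=> a h n; [move=> _; exact: h|exact: h n I].
  apply: closed_bigI => n _; apply: closed_comp.
    move=> a _; elim: n => [|n IH]; first exact: cvg_id.
    exact: (@continuous_comp _ _ _ (iter n (bwd f)) (bwd f) a IH (@bwd_continuous _ _ f _)).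
  by apply: open_closedC; exact: chart_image_open.
- by move=> /(_ 0%N) np; exact/np/chart_image_p.
- move=> a na [|n]; first by move=> /chart_image_f; exact: na 0%N.
  by rewrite iterSr fwdK; exact: na.
- by move=> a na n; rewrite -iterSr; exact: na.
Qed.

(** The first backward entry into the open disc is not in the hole: [f] sends the hole into the
    disc, so the point visited just before would already be inside. *)
Lemma reached_annulus a : outside a -> ~ unreached a ->
  exists n u, annulus u /\ iter n (bwd f) a = phi u.
Proof.
move=> oa /existsNP[n /contrapT].
elim: n a oa => [|n IH] a oa.
  move=> [v ov va]; exists 0%N, v; split=> //; apply/andP; split; last exact: ltW.
  by rewrite leNgt; apply/negP => hv; apply: oa; exists v.
rewrite iterSr => Un; have [/hole_imageE|ob] := pselect ((phi @` @hole R) (bwd f a)).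
  rewrite bwdK => -[v ov va]; exists 0%N, v; split=> //; apply/andP; split; last exact: ltW.
  by rewrite leNgt; apply/negP => hv; apply: oa; exists v.
have [m [u [au mu]]] := IH _ ob Un; exists m.+1, u; split=> //.
by rewrite iterSr.
Qed.

End Chart.

(** * Embedding the punctured tori *)

Lemma iterG_uniform (R : realType) (f : homeo (torus R) (torus R)) A F G e r kap lam :
  stable_lift A F G e r kap lam -> (forall v, tproj (F v) = f (tproj v)) ->
  forall n (eps : R), 0 < eps -> exists2 d : R, 0 < d &
  forall v w, `|w| <= d -> `|iter n G (v + w) - iter n G v| <= eps.
Proof.
move=> SL tF n eps eps0.
have [d d0 dP] : exists2 d : R, 0 < d & forall v w, [set: torus R] (tproj v) ->
    `|w| <= d -> `|iter n G (v + w) - iter n G v| <= eps.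
  apply: (torus_lebesgue (Q := fun v w => `|iter n G w - iter n G v| <= eps)).
  - exact: torus_compact.
  - move=> v w k ik; set k' := iter n G (v + k) - iter n G v.
    have ik' : k' \is a mxOver Num.int by exact: (iterG_int SL tF).
    have [k2 _ Fk2] := iter_int SL n ik'.
    have k2E : k2 = k.
      have := Fk2 (iter n G v); rewrite subrKC !(cancel_iter n (sl_GK SL)).
      by move/addrI.
    have -> : iter n G (w + k) = iter n G w + k'.
      rewrite -[RHS](cancel_iter n (sl_FK SL)) Fk2 k2E.
      by rewrite (cancel_iter n (sl_GK SL)).
    have -> : iter n G (v + k) = iter n G v + k' by rewrite subrKC.
    by rewrite opprD addrACA subrr addr0.
  move=> v _.
  have cG : {for v, continuous (iter n G)} by exact: (iter_G_continuous SL).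
  have [d d0 dP] := proj1 (nbhs_rV _ _)
    (cvgr_distC_lt (iter n G) (iter n G v) cG (eps / 2) (divr_gt0 eps0 (ltr0n _ 2))).
  exists d => // v' w' v'd w'd.
  have h1 := dP _ v'd; have h2 := dP _ w'd; rewrite !subrKC in h1 h2.
  rewrite -(subrKA (iter n G v)) (le_trans (ler_normD _ _))//.
  by rewrite [leRHS]splitr lerD// ltW// distrC.
by exists d => // v w; exact: dP.
Qed.

(** * Distances in the surface against closeness of lifts *)

Section Embedding.
Variable R : realType.
Variables (S : topologicalType) (d : S -> S -> R).
Hypothesis dm : compatible_metric d.

Lemma dist_ge0 x y : 0 <= d x y. Proof. by have [[? _ _ _] _] := dm. Qed.
Lemma dist_eq0 x y : d x y = 0 <-> x = y. Proof. by have [[_ h _ _] _] := dm. Qed.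
Lemma distC x y : d x y = d y x. Proof. by have [[_ _ h _] _] := dm. Qed.
Lemma dist_triangle x y z : d x z <= d x y + d y z. Proof. by have [[_ _ _ h] _] := dm. Qed.
Lemma distxx x : d x x = 0. Proof. exact/dist_eq0. Qed.

Lemma dist_gt0 x y : x <> y -> 0 < d x y.
Proof.
move=> xy; rewrite lt_neqAle dist_ge0 andbT eq_sym; apply/eqP => /dist_eq0; exact: xy.
Qed.

Lemma nbhs_dist x e : 0 < e -> nbhs x [set y | d x y < e].
Proof. by move=> e0; have [_ h] := dm; apply/h; exists e. Qed.

(** Points outside [K] are ignored, since the embeddings take a junk value there. *)
Definition continuous_on (T : topologicalType) (K : set T) (i : T -> S) :=
  forall a V, K a -> nbhs (i a) V -> \forall b \near a, K b -> V (i b).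

Lemma near_dist (T : topologicalType) (K : set T) (i : T -> S) a e :
  continuous_on K i -> K a -> 0 < e ->
  \forall b \near a, K b -> d (i a) (i b) < e.
Proof. by move=> ci Ka e0; exact: (ci a _ Ka (nbhs_dist (i a) e0)). Qed.

Lemma disjoint_images_apart (K1 K2 : set (torus R)) (i1 i2 : torus R -> S) :
  closed K1 -> closed K2 -> continuous_on K1 i1 -> continuous_on K2 i2 ->
  (forall a b, K1 a -> K2 b -> i1 a <> i2 b) ->
  exists2 e : R, 0 < e & forall a b, K1 a -> K2 b -> e < d (i1 a) (i2 b).
Proof.
move=> K1c K2c c1 c2 disj.
have K1k : compact K1 by apply: (subclosed_compact K1c (@torus_compact R)).
have K2k : compact K2 by apply: (subclosed_compact K2c (@torus_compact R)).
have /compact_near_coveringP cov := compact_setX K1k K2k.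
pose P (e : R) (x : torus R * torus R) := K1 x.1 -> K2 x.2 -> e < d (i1 x.1) (i2 x.2).
have nearP : \forall e \near 0^'+, K1 `*` K2 `<=` P e.
  apply: cov => -[a b] [/= Ka Kb].
  have rho0 : 0 < d (i1 a) (i2 b) by apply/dist_gt0/disj.
  set rho := d _ _ in rho0.
  have na := near_dist c1 Ka (divr_gt0 rho0 (ltr0n _ 4)).
  have nb := near_dist c2 Kb (divr_gt0 rho0 (ltr0n _ 4)).
  have near1 : \forall x \near (a, b),
      (K1 x.1 -> d (i1 a) (i1 x.1) < rho / 4) /\ (K2 x.2 -> d (i2 b) (i2 x.2) < rho / 4).
    by exists ([set a' | K1 a' -> d (i1 a) (i1 a') < rho / 4],
               [set b' | K2 b' -> d (i2 b) (i2 b') < rho / 4]) => // -[].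
  have near2 : \forall e \near 0^'+, e < rho / 4 by apply: nbhs_right_lt; rewrite divr_gt0.
  near=> x e => /= K1x K2x.
  have [/(_ K1x) h1 /(_ K2x) h2] : (K1 x.1 -> d (i1 a) (i1 x.1) < rho / 4) /\
    (K2 x.2 -> d (i2 b) (i2 x.2) < rho / 4) by near: x.
  have h3 : e < rho / 4 by near: e.
  have := dist_triangle (i1 a) (i1 x.1) (i2 b); have := dist_triangle (i1 x.1) (i2 x.2) (i2 b).
  rewrite -/rho (distC (i2 x.2)); lra.
have [e e0 eP] := near_right_ex nearP.
by exists e => // a b Ka Kb; exact: (eP (a, b)).
Unshelve. all: by end_near. Qed.

Section OneSide.
Variables (K : set (torus R)) (i : torus R -> S).
Hypothesis Kc : closed K.
Hypothesis ci : continuous_on K i.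
Hypothesis ii : forall a b, K a -> K b -> i a = i b -> a = b.

Let Kk : compact K. Proof. exact: (subclosed_compact Kc (@torus_compact R)). Qed.

Lemma dist_near_t eps : 0 < eps -> exists2 e : R, 0 < e &
  forall a b, K a -> K b -> d (i a) (i b) <= e -> near_t eps a b.
Proof.
move=> eps0; have /compact_near_coveringP cov := compact_setX Kk Kk.
pose P (e : R) (x : torus R * torus R) :=
  K x.1 -> K x.2 -> d (i x.1) (i x.2) <= e -> near_t eps x.1 x.2.
have nearP : \forall e \near 0^'+, K `*` K `<=` P e.
  apply: cov => -[a b] [/= Ka Kb]; have [ab|ab] := pselect (a = b).
    subst b; have [v va] := tproj_surj a; subst a.
    have nv : \forall x \near tproj v, exists2 w, `|w| < eps / 2 & tproj (v + w) = x.
      by apply/near_tproj; exists (eps / 2) => [|w we]; [rewrite divr_gt0|exists w].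
    have near1 : \forall x \near (tproj v, tproj v), near_t eps x.1 x.2.
      exists ([set x | exists2 w, `|w| < eps / 2 & tproj (v + w) = x],
              [set x | exists2 w, `|w| < eps / 2 & tproj (v + w) = x]) => //.
      move=> [_ _] [/= [w we <-] [w' we' <-]]; exists (v + w), (w' - w); split=> //.
        by rewrite addrA addrAC addrK.
      by rewrite (le_trans (ler_normB _ _))//; lra.
    near=> x e => /= _ _ _; near: x; exact: near1.
  have rho0 : 0 < d (i a) (i b) by apply: dist_gt0 => /(ii Ka Kb).
  set rho := d _ _ in rho0.
  have na := near_dist ci Ka (divr_gt0 rho0 (ltr0n _ 4)).
  have nb := near_dist ci Kb (divr_gt0 rho0 (ltr0n _ 4)).
  have near1 : \forall x \near (a, b),
      (K x.1 -> d (i a) (i x.1) < rho / 4) /\ (K x.2 -> d (i b) (i x.2) < rho / 4).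
    by exists ([set a' | K a' -> d (i a) (i a') < rho / 4],
               [set b' | K b' -> d (i b) (i b') < rho / 4]) => // -[].
  have near2 : \forall e \near 0^'+, e < rho / 4 by apply: nbhs_right_lt; rewrite divr_gt0.
  near=> x e => /= K1x K2x dx; exfalso.
  have [/(_ K1x) h1 /(_ K2x) h2] : (K x.1 -> d (i a) (i x.1) < rho / 4) /\
    (K x.2 -> d (i b) (i x.2) < rho / 4) by near: x.
  have h3 : e < rho / 4 by near: e.
  have := dist_triangle (i a) (i x.1) (i b); have := dist_triangle (i x.1) (i x.2) (i b).
  rewrite -/rho (distC (i x.2)); lra.
have [e e0 eP] := near_right_ex nearP.
by exists e => // a b Ka Kb; exact: (eP (a, b)).
Unshelve. all: by end_near. Qed.

Lemma near_t_dist e : 0 < e -> exists2 eps : R, 0 < eps &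
  forall a b, K a -> K b -> near_t eps a b -> d (i a) (i b) <= e.
Proof.
move=> e0; have /compact_near_coveringP cov := Kk.
pose P (eps : R) (a : torus R) := K a -> forall b, K b -> near_t eps a b -> d (i a) (i b) <= e.
have nearP : \forall eps \near 0^'+, K `<=` P eps.
  apply: cov => a Ka; have [v va] := tproj_surj a; subst a.
  have /near_tproj[c c0 cP] := near_dist ci Ka (divr_gt0 e0 (ltr0n _ 2)).
  have near1 : \forall x \near tproj v, exists2 w, `|w| < c / 2 & tproj (v + w) = x.
    by apply/near_tproj; exists (c / 2) => [|w we]; [rewrite divr_gt0|exists w].
  have near2 : \forall eps \near 0^'+, eps < c / 2 by apply: nbhs_right_lt; rewrite divr_gt0.
  near=> x eps => /= Kx b Kb xb.
  have [w wc wx] : exists2 w, `|w| < c / 2 & tproj (v + w) = x by near: x.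
  have h3 : eps < c / 2 by near: eps.
  have [w' w'b w'e] := near_t_lift xb wx.
  have h1 : d (i (tproj v)) (i x) < e / 2 by rewrite -wx; apply: cP; [lra|rewrite wx].
  have h2 : d (i (tproj v)) (i b) < e / 2.
    rewrite -w'b -addrA; apply: cP; last by rewrite addrA w'b.
    by rewrite (le_lt_trans (ler_normD _ _))//; lra.
  have := dist_triangle (i x) (i (tproj v)) (i b); rewrite (distC (i x) (i (tproj v))); lra.
have [eps eps0 epsP] := near_right_ex nearP.
by exists eps => // a b Ka Kb; exact: (epsP a).
Unshelve. all: by end_near. Qed.

End OneSide.
End Embedding.

(** * One punctured torus inside the surface *)

Section Half.
Variable R : realType.
Local Notation plane := 'rV[R]_2.
Variables (f : homeo (torus R) (torus R)).
Variables (A : 'M[int]_2) (F G : plane -> plane) (e : plane).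
Variables (r : 'cV[R]_2) (kap lam : R) (p : torus R).
Hypothesis SL : stable_lift A F G e r kap lam.
Hypothesis tF : forall v, tproj (F v) = f (tproj v).
Hypothesis stab : forall w, stable_space A w <-> transverse r w = 0.
Hypothesis con : contracting f F e p.
Variables (phi : plane -> torus R) (j : 'I_2).
Hypothesis phi_chart : local_chart phi.
Hypothesis phi0 : phi 0 = p.
Hypothesis phi_f : forall v, disc v -> bwd f (phi v) = phi (4^-1 *: v).
Hypothesis phi_leaf : forall v, disc v ->
  pullback_leaf phi (stable_leaf A) v = @disc R `&` [set w | w 0 j = v 0 j].
Variables (S : topologicalType) (d : S -> S -> R).
Hypothesis dm : compatible_metric d.
Variables (i : torus R -> S) (g : S -> S).
Local Notation K := (outside phi).
Hypothesis ci : continuous_on K i.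
Hypothesis ii : forall a b, K a -> K b -> i a = i b -> a = b.
Hypothesis gi : forall a, K a -> g (i a) = i (f a).

Let Kc : closed K. Proof. exact: (outside_closed phi_chart phi_f). Qed.
Let Kf a : K a -> K (f a). Proof. exact: (outside_f phi_f). Qed.

Lemma outside_iter n a : K a -> K (iter n f a).
Proof. by move=> Ka; elim: n => // n; exact: Kf. Qed.

Lemma iter_embed n a : K a -> iter n g (i a) = i (iter n f a).
Proof.
by move=> Ka; elim: n => // n IH; rewrite !iterS IH gi//; exact: outside_iter.
Qed.

(** Forward closeness puts the points on one stable leaf; the [m] backward steps serve to bring the
    first point into the inner disc, where [leaf_in_chart] reads the leaf as a coordinate line. *)
Lemma half_leaf m : exists2 eps : R, 0 < eps & forall a b, K a -> K b ->
  (forall n, d (iter n g (i a)) (iter n g (i b)) <= eps) ->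
  forall u, enorm u <= 2^-1 -> iter m (bwd f) a = phi u ->
  exists u', [/\ disc u', phi u' = iter m (bwd f) b & u' 0 j = u 0 j].
Proof.
have [e1 e10 e1P] := leaf_in_chart stab phi_chart phi_leaf.
have [e2 e20 e2P] := iterG_uniform SL tF m e10.
have [e3 e30 e3P] := forward_close_leaf SL tF.
have e230 : 0 < Num.min e2 e3 by rewrite lt_min e20.
have [eps eps0 epsP] := dist_near_t dm Kc ci ii e230.
exists eps => // a b Ka Kb ab u us ua.
have near n : near_t (Num.min e2 e3) (iter n f a) (iter n f b).
  by apply: epsP; [exact: outside_iter|exact: outside_iter|rewrite -!iter_embed].
have le3 : Num.min e2 e3 <= e3 by rewrite ge_min lexx orbT.
have [v [w [va wb ew wn]]] := e3P _ le3 _ _ near.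
have w2 : `|w| <= e2.
  have := wn 0%N; rewrite /= addrAC subrr add0r => h.
  by rewrite (le_trans h)// ge_min lexx.
have [u' [du' u'E u'j]] := e1P u us (iter m G v) (iter m G (v + w) - iter m G v)
  ltac:(by rewrite (tproj_iterG SL tF) va) (ell_iterG SL _ _ ew) (e2P _ _ w2).
exists u'; split=> //; by rewrite u'E subrKC (tproj_iterG SL tF) wb.
Qed.

Lemma unreached_outside a : unreached f phi a -> K a.
Proof. by move=> /(_ 0%N) /= na /(hole_imageE phi_f)/(chart_image_f phi_f). Qed.

Lemma unreached_bwd n a : unreached f phi a -> unreached f phi (iter n (bwd f) a).
Proof. by move=> na m; rewrite -iterD; exact: na. Qed.

Lemma iter_bwd_embed (gb : S -> S) n a : cancel g gb -> unreached f phi a ->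
  iter n gb (i a) = i (iter n (bwd f) a).
Proof.
move=> gK na; have -> : i a = iter n g (i (iter n (bwd f) a)).
  rewrite iter_embed ?(cancel_iter n (@bwdK _ _ f))//.
  exact/unreached_outside/unreached_bwd.
by rewrite (cancel_iter n gK).
Qed.

Lemma half_expansive (gb : S -> S) : cancel g gb -> exists2 eps : R, 0 < eps &
  forall a b, unreached f phi a -> unreached f phi b ->
  (forall n, d (iter n g (i a)) (iter n g (i b)) <= eps) ->
  (forall n, d (iter n gb (i a)) (iter n gb (i b)) <= eps) -> a = b.
Proof.
move=> gK; have [e1 e10 e1P] := unreached_expansive SL tF con phi_chart phi0 phi_f.
have [eps eps0 epsP] := dist_near_t dm Kc ci ii e10.
exists eps => // a b na nb fab bab.
have Ka := unreached_outside na; have Kb := unreached_outside nb.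
apply: e1P => // n; apply: epsP.
- exact: outside_iter.
- exact: outside_iter.
- by rewrite -!iter_embed.
- exact/unreached_outside/unreached_bwd.
- exact/unreached_outside/unreached_bwd.
- by rewrite -!(iter_bwd_embed _ gK).
Qed.

Lemma half_stable eps : 0 < eps -> exists2 c : R, 0 < c &
  forall u u', annulus u -> annulus u' -> u' 0 j = u 0 j -> `|u' - u| <= c ->
  forall n, d (iter n g (i (phi u))) (iter n g (i (phi u'))) <= eps.
Proof.
move=> eps0; have [e1 e10 e1P] := near_t_dist dm Kc ci eps0.
have [c c0 cP] := chart_leaf_stable SL tF stab con phi_chart phi0 phi_f phi_leaf e10.
exists c => // u u' au au' uj uc n.
have Ku := annulus_outside phi_chart au; have Ku' := annulus_outside phi_chart au'.
rewrite !iter_embed//; apply: e1P; [exact: outside_iter|exact: outside_iter|].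
exact: cP.
Qed.

End Half.

(** * Orbits staying close in the glued surface *)

Section Inversion.
Variable R : realType.
Local Notation plane := 'rV[R]_2.

Lemma enorm_inversion (v : plane) : enorm (inversion v) = (enorm v)^-1.
Proof.
have [->|v0] := eqVneq v 0.
  rewrite /inversion scaler0 /enorm big1 ?sqrtr0 ?invr0// => i _.
  by rewrite mxE expr0n.
rewrite /inversion enormZ ger0_norm ?invr_ge0 ?sqr_ge0// expr2 invfM -mulrA mulVf ?mulr1//.
by rewrite gt_eqF// enorm_gt0.
Qed.

Lemma inversionK (v : plane) : 0 < enorm v -> inversion (inversion v) = v.
Proof.
move=> v0; rewrite {1}/inversion enorm_inversion exprVn invrK /inversion scalerA.
by rewrite divff ?scale1r// expf_neq0// gt_eqF.
Qed.

Lemma inversionZ (c : R) (v : plane) : 0 < c -> inversion (c *: v) = c^-1 *: inversion v.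
Proof.
move=> c0; rewrite /inversion enorm_scale ?ltW// !scalerA; congr (_ *: _).
by rewrite exprMn invfM mulrAC; congr (_ * _); rewrite expr2 invfM divfK// gt_eqF.
Qed.

Lemma annulus_gt0 (v : plane) : annulus v -> 0 < enorm v.
Proof. by case/andP => h _; apply: lt_le_trans h. Qed.

Lemma annulus_inversion (v : plane) : annulus v -> annulus (inversion v).
Proof.
move=> av; have v0 := annulus_gt0 av; case/andP: av => h1 h2.
rewrite /annulus /= enorm_inversion; apply/andP; split.
  by rewrite lef_pV2 ?posrE.
by rewrite -[leRHS]invrK lef_pV2 ?posrE// invr_gt0.
Qed.

End Inversion.

Section Assembly.
Variable R : realType.
Local Notation plane := 'rV[R]_2.

(** [j] is the coordinate that is constant on leaves: 0 for the vertical foliation, 1 for the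
    horizontal one. *)
Record half_chart (f : homeo (torus R) (torus R)) (A : 'M[int]_2) (p : torus R)
    (phi : plane -> torus R) (j : 'I_2) : Prop := HalfChart {
  hc_chart : local_chart phi;
  hc_0 : phi 0 = p;
  hc_f : forall v, disc v -> bwd f (phi v) = phi (4^-1 *: v);
  hc_leaf : forall v, disc v ->
    pullback_leaf phi (stable_leaf A) v = @disc R `&` [set w | w 0 j = v 0 j] }.

(** For the second torus [g] will be the inverse of the glued map, so that [f] is the same
    diffeomorphism in both halves. *)
Record half_embedding (S : topologicalType) (f : homeo (torus R) (torus R))
    (phi : plane -> torus R) (i : torus R -> S) (g : S -> S) : Prop := HalfEmbedding {
  he_cont : continuous_on (outside phi) i;
  he_inj : forall a b, outside phi a -> outside phi b -> i a = i b -> a = b;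
  he_comm : forall a, outside phi a -> g (i a) = i (f a) }.

Definition orbit_close (S : Type) (d : S -> S -> R) (g gb : S -> S) (eps : R) (x y : S) :=
  (forall n, d (iter n g x) (iter n g y) <= eps) /\
  (forall n, d (iter n gb x) (iter n gb y) <= eps).

Variables (f : homeo (torus R) (torus R)).
Variables (A : 'M[int]_2) (F G : plane -> plane) (e : plane).
Variables (r : 'cV[R]_2) (kap lam : R) (p : torus R).
Hypothesis SL : stable_lift A F G e r kap lam.
Hypothesis tF : forall v, tproj (F v) = f (tproj v).
Hypothesis stab : forall w, stable_space A w <-> transverse r w = 0.
Hypothesis con : contracting f F e p.
Variables (phi chi : plane -> torus R) (j k : 'I_2).
Hypothesis C1 : half_chart f A p phi j.
Hypothesis C2 : half_chart f A p chi k.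
Variables (S : topologicalType) (d : S -> S -> R).
Hypothesis dm : compatible_metric d.
Variables (i1 i2 : torus R -> S) (g gb : S -> S).
Hypothesis gK : cancel g gb.
Hypothesis E1 : half_embedding f phi i1 g.
Hypothesis E2 : half_embedding f chi i2 gb.
Hypothesis glue : forall v, annulus v -> i1 (phi v) = i2 (chi (inversion v)).
Hypothesis glue_inv : forall a b, outside phi a -> outside chi b -> i1 a = i2 b ->
  exists v, [/\ annulus v, a = phi v & b = chi (inversion v)].

Lemma chart_quadruple psi l u : half_chart f A p psi l -> disc (4 *: u) ->
  f (psi u) = psi (4 *: u).
Proof.
move=> C d4; rewrite -[RHS](@bwdK _ _ f) (hc_f C)//.
by rewrite scalerK.
Qed.

Lemma chart_inj psi l u u' : half_chart f A p psi l -> disc u -> disc u' ->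
  psi u = psi u' -> u = u'.
Proof. by move=> C du du'; have [_ inj _] := hc_chart C; apply: inj; rewrite inE. Qed.

(** Forward closeness fixes a coordinate of [u] in the first chart; backward closeness, read in the
    other torus through the gluing, fixes one of its inversion. The point [b] may lie beyond the
    chart disc but is inside one step earlier, hence the quarter of [u] and the radius 8. *)
Lemma close_annulus : exists2 eps : R, 0 < eps & forall v b, annulus v ->
  outside phi b -> orbit_close d g gb eps (i1 (phi v)) (i1 b) ->
  exists u, [/\ 2^-1 <= enorm u <= 8, u 0 j = v 0 j,
    inversion u 0 k = inversion v 0 k & b = f (phi (4^-1 *: u))].
Proof.
have [e1 e10 e1P] := half_leaf SL tF stab (hc_chart C1) (hc_f C1) (hc_leaf C1) dm
  (he_cont E1) (he_inj E1) (he_comm E1) 1.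
have [e2 e20 e2P] := half_leaf SL tF stab (hc_chart C2) (hc_f C2) (hc_leaf C2) dm
  (he_cont E2) (he_inj E2) (he_comm E2) 1.
have [e3 e30 e3P] := half_leaf SL tF stab (hc_chart C2) (hc_f C2) (hc_leaf C2) dm
  (he_cont E2) (he_inj E2) (he_comm E2) 2.
exists (Num.min e1 (Num.min e2 e3)) => [|v b av ob [fwdc bwdc]].
  by rewrite !lt_min e10 e20.
have fwd1 n : d (iter n g (i1 (phi v))) (iter n g (i1 b)) <= e1.
  by rewrite (le_trans (fwdc n))// ge_min lexx.
have bwd2 n : d (iter n gb (i1 (phi v))) (iter n gb (i1 b)) <= e2.
  by rewrite (le_trans (bwdc n))// !ge_min lexx orbT.
have bwd3 n : d (iter n gb (i1 (phi v))) (iter n gb (i1 b)) <= e3.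
  by rewrite (le_trans (bwdc n))// !ge_min lexx !orbT.
have av' := annulus_inversion av; have v0 := annulus_gt0 av.
have quarter (w : plane) : annulus w -> enorm (4^-1 *: w) <= 2^-1.
  by case/andP => _ w2; rewrite enorm_scale//; lra.
have ov : outside phi (phi v) := annulus_outside (hc_chart C1) av.
have ov' : outside chi (chi (inversion v)) := annulus_outside (hc_chart C2) av'.
have [u1 [du1 u1E u1j]] := e1P (phi v) b ov ob fwd1 (4^-1 *: v) (quarter v av)
  (hc_f C1 (annulus_disc av)).
have bE : b = f (phi u1) by rewrite u1E /= bwdK.
have u18 : 8^-1 <= enorm u1.
  rewrite leNgt; apply/negP => lt; apply: ob; exists (4 *: u1).
    by rewrite /hole /= enorm_scale//; lra.
  by rewrite bE (chart_quadruple C1)// /disc /= enorm_scale//; lra.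
have u12 : enorm u1 <= 2 := du1.
have u10 : 0 < enorm u1 by lra.
exists (4 *: u1); rewrite scalerK// enorm_scale//; split=> //.
- by apply/andP; split; lra.
- by rewrite mxE u1j mxE; field.
(* If [b] is beyond the annulus, its predecessor is still in it. The comparison in the other torus
   then starts one step later and needs two backward steps of [f]. *)
have [le2|gt2] := leP (enorm u1) 2^-1.
  have au : annulus (4 *: u1) by rewrite /annulus /= enorm_scale//; apply/andP; split; lra.
  have au' := annulus_inversion au.
  have bE2 : b = phi (4 *: u1) by rewrite bE (chart_quadruple C1)//; exact: annulus_disc.
  have ou' := annulus_outside (hc_chart C2) au'.
  rewrite (glue av) bE2 (glue au) in bwd2.
  have [u2 [du2 u2E u2k]] := e2P _ _ ov' ou' bwd2 (4^-1 *: inversion v)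
    (quarter _ av') (hc_f C2 (annulus_disc av')).
  have : u2 = 4^-1 *: inversion (4 *: u1).
    apply: (chart_inj C2) => //; first exact/disc_quarter/annulus_disc.
    by rewrite u2E /= (hc_f C2 (annulus_disc au')).
  move=> u2q; rewrite u2q [LHS]mxE [RHS]mxE in u2k.
  by apply: (mulfI _ u2k); rewrite invr_eq0.
have au : annulus u1 by apply/andP; split; [exact: ltW|].
have au' := annulus_inversion au.
have ou : outside phi (phi u1) := annulus_outside (hc_chart C1) au.
have ou' := annulus_outside (hc_chart C2) au'.
have gbx : gb (i1 (phi v)) = i2 (f (chi (inversion v))).
  by rewrite (glue av) (he_comm E2).
have gby : gb (i1 b) = i2 (chi (inversion u1)).
  by rewrite bE -(he_comm E1)// gK glue.
have bwd3' n : d (iter n gb (i2 (f (chi (inversion v))))) (iter n gb (i2 (chi (inversion u1)))) <= e3.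
  by rewrite -gbx -gby -!iterSr; exact: bwd3.
have [u2 [du2 u2E u2k]] := e3P _ _ (outside_f (hc_f C2) ov') ou' bwd3'
  (4^-1 *: inversion v) (quarter _ av')
  ltac:(by rewrite /= fwdK (hc_f C2)//; exact: annulus_disc).
have : u2 = 4^-1 *: (4^-1 *: inversion u1).
  apply: (chart_inj C2) => //; first exact/disc_quarter/disc_quarter/annulus_disc.
  rewrite u2E /= (hc_f C2 (annulus_disc au')) (hc_f C2)//.
  exact/disc_quarter/annulus_disc.
move=> u2q; rewrite u2q [LHS]mxE [RHS]mxE in u2k.
rewrite inversionZ//; by apply: (mulfI _ u2k); rewrite invr_eq0.
Qed.

Lemma bwd_into_chi n a u : iter n (bwd f) a = phi u -> annulus u -> outside phi a ->
  iter n gb (i1 a) = i2 (chi (inversion u)).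
Proof.
move=> au Au oa.
have -> : i1 a = iter n g (i1 (phi u)).
  rewrite (iter_embed (hc_f C1) (he_comm E1)) -?au ?(cancel_iter n (@bwdK _ _ f))//.
  by rewrite au; exact: (annulus_outside (hc_chart C1)).
by rewrite (cancel_iter n gK) glue.
Qed.

Lemma outside_not_image psi l c : half_chart f A p psi l -> outside psi c ->
  ~ chart_image psi (f c).
Proof. by move=> C oc /(hole_imageE (hc_f C)). Qed.

(** The backward orbit of [i1 a] avoids the first disc, so it keeps a positive distance from the
    second torus off its own disc. A close orbit can then never enter the second torus backwards; it
    comes from an [unreached] point of the first, where expansivity holds. *)
Lemma close_unreached : exists2 eps : R, 0 < eps & forall a y, unreached f phi a ->
  orbit_close d g gb eps (i1 a) y ->
  (exists2 b, outside phi b & y = i1 b) \/ (exists2 b, outside chi b & y = i2 b) ->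
  y = i1 a.
Proof.
have notU psi l a : half_chart f A p psi l -> ~ chart_image psi a -> outside psi a.
  by move=> C nU /(hole_imageE (hc_f C))/(chart_image_f (hc_f C)).
have cU psi l : half_chart f A p psi l -> closed (~` chart_image psi).
  by move=> C; apply: open_closedC; exact: chart_image_open (hc_chart C).
have [e1 e10 e1P] : exists2 e : R, 0 < e & forall a b, ~ chart_image phi a ->
    ~ chart_image chi b -> e < d (i1 a) (i2 b).
  apply: (disjoint_images_apart dm (cU _ _ C1) (cU _ _ C2)).
  - move=> a V na iaV; have := he_cont E1 (notU _ _ _ C1 na) iaV.
    by apply: filterS => b bV nb; exact/bV/(notU _ _ _ C1).
  - move=> a V na iaV; have := he_cont E2 (notU _ _ _ C2 na) iaV.
    by apply: filterS => b bV nb; exact/bV/(notU _ _ _ C2).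
  move=> a b na nb ab.
  have [v [av va vb]] := glue_inv (notU _ _ _ C1 na) (notU _ _ _ C2 nb) ab.
  have v2 : 2 <= enorm v by rewrite leNgt; apply/negP => lt; apply: na; exists v.
  apply: nb; exists (inversion v) => //; rewrite /open_disc /= enorm_inversion.
  rewrite (@le_lt_trans _ _ 2^-1)//; last by lra.
  by rewrite lef_pV2 ?posrE// (annulus_gt0 av).
have [e2 e20 e2P] := half_expansive SL tF con (hc_chart C1) (hc_0 C1) (hc_f C1)
  dm (he_cont E1) (he_inj E1) (he_comm E1) gK.
exists (Num.min e1 e2) => [|a y na [fwdc bwdc] yin]; first by rewrite lt_min e10.
have oa := unreached_outside (hc_f C1) na.
(* One extra step is taken because [f] moves a point outside the hole to a point outside the open
   disc. *)
have far n c : outside chi c -> iter n gb y = i2 c -> False.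
  move=> oc yc; have := bwdc n.+1; rewrite !iterS yc (he_comm E2)//.
  rewrite -iterS (iter_bwd_embed (hc_f C1) (he_comm E1) n.+1 gK na).
  have := e1P _ _ (na n.+1) (outside_not_image C2 oc).
  by rewrite le_min => h /andP[h2 _]; lra.
have [[b ob yb]|[b ob yb]] := yin; last by have := far 0%N b ob yb.
have [nb|rb] := pselect (unreached f phi b).
  rewrite yb; congr i1; apply/esym; apply: e2P => // n; rewrite -yb.
    by rewrite (le_trans (fwdc n))// ge_min lexx orbT.
  by rewrite (le_trans (bwdc n))// ge_min lexx orbT.
have [n [u [au ub]]] := reached_annulus (hc_f C1) ob rb.
exfalso; apply: (far n (chi (inversion u))).
  exact: (annulus_outside (hc_chart C2)) (annulus_inversion au).
by rewrite yb; exact: bwd_into_chi.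
Qed.

End Assembly.

(** * The bitorus *)

Section Bitorus.
Variable R : realType.
Local Notation plane := 'rV[R]_2.
Variables phi1 phi2 : plane -> torus R.
Local Notation S := (bitorus phi1 phi2).
Local Notation P := (punctured phi1 phi2).

(* [s0] is a junk value, taken outside the punctured tori. *)
Definition embed (s0 : S) (b : bool) (a : torus R) : S :=
  match pselect (P (b, a)) with
  | left H => bclass (exist _ (b, a) (mem_set H) : set_type P)
  | right _ => s0
  end.

Lemma embedE s0 (x : set_type P) b a : val x = (b, a) -> bclass x = embed s0 b a.
Proof.
move=> xE; rewrite /embed; case: pselect => [H|nH]; first by congr bclass; exact: val_inj.
by exfalso; apply: nH; rewrite -xE; exact: set_valP.
Qed.

Lemma embed_val s0 b a (H : P (b, a)) :
  exists2 x : set_type P, val x = (b, a) & embed s0 b a = bclass x.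
Proof.
exists (exist _ (b, a) (mem_set H)) => //.
by rewrite [RHS](@embedE s0 _ b a).
Qed.

Lemma embed_surj s0 (s : S) : exists b a, P (b, a) /\ s = embed s0 b a.
Proof.
exists (val (repr s)).1, (val (repr s)).2; split.
  by rewrite -surjective_pairing; exact: set_valP.
rewrite -(@embedE s0 (repr s)); last exact: surjective_pairing.
by rewrite /bclass reprK.
Qed.

Lemma embed_continuous s0 b : continuous_on [set a | P (b, a)] (embed s0 b).
Proof.
move=> a V Pa; have [x xE ->] := embed_val s0 Pa => nV.
have : nbhs x (@bclass _ phi1 phi2 @^-1` V) by exact: (pi_continuous nV).
rewrite nbhsE => -[W [[Y Yo YW] Wx] WV].
have Oba : nbhs (b, a) Y.
  by apply: open_nbhs_nbhs; split=> //; rewrite -xE; move: Wx; rewrite -YW.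
have [[B1 B2] [/= B1b B2a] B12] := Oba.
apply: filterS B2a => a' B2a' Pa'; have [x' x'E ->] := embed_val s0 Pa'.
have Yx : Y (val x') by rewrite x'E; apply: B12; split=> //=; exact: nbhs_singleton.
by apply: WV; rewrite -YW; exact: Yx.
Qed.

Hypothesis phi1_chart : local_chart phi1.
Hypothesis phi2_chart : local_chart phi2.

Lemma glue_functional x y z : glue_rel x y -> glue_rel x z ->
  y = z :> set_type P.
Proof.
move=> [v [av xv yv]] [w [aw xw zw]]; apply: val_inj; rewrite yv zw.
have [_ inj _] := phi1_chart.
suff -> : v = w by [].
apply: inj; rewrite ?inE; [exact: annulus_disc|exact: annulus_disc|].
by move: xv; rewrite xw => -[].
Qed.

Lemma glue_injective x y z : glue_rel y x -> glue_rel z x ->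
  y = z :> set_type P.
Proof.
move=> [v [av yv xv]] [w [aw zw xw]]; apply: val_inj; rewrite yv zw.
have [_ inj _] := phi2_chart.
suff -> : v = w by [].
rewrite -(inversionK (annulus_gt0 av)) -(inversionK (annulus_gt0 aw)); congr inversion.
apply: inj; rewrite ?inE; [exact/annulus_disc/annulus_inversion|exact/annulus_disc/annulus_inversion|].
by move: xv; rewrite xw => -[].
Qed.

(** The gluing goes from the first copy to the second, so it does not compose with itself; being
    functional and injective, it makes every zigzag collapse. *)
Lemma bclass_eq (x y : set_type P) : bclass x = bclass y ->
  [\/ x = y, glue_rel x y | glue_rel y x].
Proof.
move=> /eqmodP /asboolP; elim => {x y}.
- by move=> x y xy; exact: Or32.
- by move=> x; exact: Or31.
- by move=> x y _ [->|h|h]; [exact: Or31|exact: Or33|exact: Or32].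
have no x y z : glue_rel x y -> glue_rel y z -> False.
  by move=> [v [_ _ yv]] [w [_ yw _]]; rewrite yv in yw.
move=> x y z _ [->|h|h] _ [<-|k|k].
- exact: Or31.
- exact: Or32.
- exact: Or33.
- exact: Or32.
- by exfalso; exact: no h k.
- by apply: Or31; exact: glue_injective h k.
- exact: Or33.
- by apply: Or31; exact: glue_functional h k.
- by exfalso; exact: no k h.
Qed.

Lemma embed_inj s0 b a a' : P (b, a) -> P (b, a') ->
  embed s0 b a = embed s0 b a' -> a = a'.
Proof.
move=> Pa Pa'; have [x xE ->] := embed_val s0 Pa; have [x' x'E ->] := embed_val s0 Pa'.
move=> /bclass_eq[xx'|[v [_ xv xv']]|[v [_ xv xv']]].
- by move: xE; rewrite xx' x'E => -[].
- by move: xE x'E; rewrite xv xv' => -[<-].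
- by move: xE x'E; rewrite xv xv' => -[<-].
Qed.

Lemma embed_glue s0 v : annulus v -> P (false, phi1 v) -> P (true, phi2 (inversion v)) ->
  embed s0 false (phi1 v) = embed s0 true (phi2 (inversion v)).
Proof.
move=> av P1 P2; have [x xE ->] := embed_val s0 P1; have [y yE ->] := embed_val s0 P2.
by apply/eqmodP/asboolP/rst_step; exists v.
Qed.

Lemma embed_glue_inv s0 a b : P (false, a) -> P (true, b) ->
  embed s0 false a = embed s0 true b ->
  exists v, [/\ annulus v, a = phi1 v & b = phi2 (inversion v)].
Proof.
move=> P1 P2; have [x xE ->] := embed_val s0 P1; have [y yE ->] := embed_val s0 P2.
move=> /bclass_eq[xy|[v [av xv yv]]|[v [av yv xv]]].
- by move: xE; rewrite xy yE.
- by exists v; split=> //; [move: xE; rewrite xv => -[]|move: yE; rewrite yv => -[]].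
- by move: xE; rewrite xv.
Qed.

End Bitorus.

(** * Intersections of leaves and cardinality bounds *)

Section Counting.
Variable R : realType.
Local Notation plane := 'rV[R]_2.

(* A vertical line meets a circle tangent to the horizontal axis at the origin
   in at most two points. *)
Lemma vertical_circle (u v : plane) : 0 < enorm u -> 0 < enorm v ->
  u 0 0 = v 0 0 -> inversion u 0 1 = inversion v 0 1 ->
  u = v \/ u = \row_i (if i == 0 then v 0 0 else v 0 0 ^+ 2 / v 0 1).
Proof.
have sqE (w : plane) : enorm w ^+ 2 = w 0 0 ^+ 2 + w 0 1 ^+ 2.
  by rewrite /enorm sqr_sqrtr sum2E// addr_ge0 ?sqr_ge0.
move=> u0 v0 uv0; rewrite /inversion !mxE => uv1.
have nu : enorm u ^+ 2 != 0 by rewrite expf_neq0// gt_eqF.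
have nv : enorm v ^+ 2 != 0 by rewrite expf_neq0// gt_eqF.
have cross : u 0 1 * (v 0 0 ^+ 2 + v 0 1 ^+ 2) = v 0 1 * (v 0 0 ^+ 2 + u 0 1 ^+ 2).
  rewrite -{2}uv0 -!sqE; apply: (mulfI (mulf_neq0 (invr_neq0 nu) (invr_neq0 nv))).
  transitivity ((enorm u ^+ 2)^-1 * u 0 1); first by field; rewrite !gt_eqF.
  by rewrite uv1; field; rewrite !gt_eqF.
(* With a common abscissa the equation is quadratic in the ordinate of [u]; one root is the ordinate
   of [v], and the product of the roots is [v 0 0 ^+ 2]. *)
have : (u 0 1 - v 0 1) * (v 0 0 ^+ 2 - u 0 1 * v 0 1) = 0.
  by apply/eqP; rewrite -subr_eq0 subr0; move/eqP: cross; rewrite -subr_eq0 => /eqP <-; apply/eqP; ring.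
move/eqP; rewrite mulf_eq0 !subr_eq0 => /orP[/eqP h|/eqP h].
  by left; exact: rV2P.
(* On the horizontal axis the second factor could vanish only at the origin. *)
have [v1|v1] := eqVneq (v 0 1) 0.
  exfalso; rewrite v1 mulr0 in h; have := exprn_gt0 2 v0.
  by rewrite sqE h v1 expr0n addr0 ltxx.
right; apply: rV2P; rewrite mxE //= h mulfK//.
Qed.

Lemma card_le_pair (T : Type) (X : set T) (p q : T) :
  (forall y, X y -> y = p \/ y = q) -> (X #<= `I_2)%card.
Proof.
move=> Xpq.
apply: (@card_le_trans _ _ _ [set (if n == 0%N then p else q) | n in `I_2]).
  by apply: subset_card_le => y /Xpq[->|->]; [exists 0%N|exists 1%N].
exact: card_image_le.
Qed.

Lemma card_gt1 (T : Type) (X : set T) (p q : T) :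
  X p -> X q -> p <> q -> ~ (X #<= `I_1)%card.
Proof.
move=> Xp Xq pq X1.
have h : (`I_2 #<= X)%card.
  apply: (@card_le_trans _ _ _ [set (if `[< z = p >] then 0%N else 1%N) | z in X]).
    apply: subset_card_le => -[|[|//]] _.
      by exists p => //; case: asboolP.
    by exists q => //; case: asboolP => // qp; case: pq.
  exact: card_image_le.
by have := card_le_trans h X1; rewrite card_le_II.
Qed.

End Counting.

Theorem proposition6p1 (R : realType)
  (A : 'M[int]_2)
  (f1 f2 h : homeo (torus R) (torus R))
  (p1 p2 : torus R)
  (phi1 phi2 : 'rV[R]_2 -> torus R)
  (Hf1 : derived_from_anosov A f1 p1)
  (Hf2 : diffeomorphism f2)
  (Hconj : forall x, f2 (h x) = h (bwd f1 x))
  (Hp : h p1 = p2)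
  (Hp2 : fixed_sink f2 p2)
  (Hphi1 : local_chart phi1)
  (Hphi2 : local_chart phi2)
  (Hc1 : phi1 0 = p1 /\ phi2 0 = p2)
  (Hc2 : pullback_vertical phi1 (stable_leaf A) /\
         pullback_horizontal phi2
           (fun y => h @` stable_leaf A (bwd h y)))
  (Hc3 : forall v, disc v ->
         bwd f1 (phi1 v) = phi1 (4^-1 *: v) /\
         f2 (phi2 v) = phi2 (4^-1 *: v))
  (f : homeo (bitorus phi1 phi2) (bitorus phi1 phi2))
  (Hf : glued_map f1 f2 f)
  (d : bitorus phi1 phi2 -> bitorus phi1 phi2 -> R)
  (Hd : compatible_metric d) :
  n_expansive d f 2 /\ ~ expansive d f.
Proof.
have [F [G [e [r [kap [lam [SL tF stab con]]]]]]] := da_stable_lift Hf1.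
pose chi v := bwd h (phi2 v).
have C1 : half_chart f1 A p1 phi1 0.
  by split; [exact: Hphi1|exact: Hc1.1|move=> v /Hc3[]|exact: Hc2.1].
have hole2 a : (phi2 @` @hole R) (h a) <-> (chi @` @hole R) a.
  split=> -[v hv va]; exists v => //; first by rewrite /chi va fwdK.
  by rewrite -va /chi bwdK.
have C2 : half_chart f1 A p1 chi 1.
  have [c2 inj2 o2] := Hphi2; split.
  - split.
    + apply/subspace_continuousP => v dv; have := (proj1 (subspace_continuousP _ _) c2) v dv.
      by move=> cv; apply: (cvg_comp _ _ cv); exact: bwd_continuous.
    + by move=> u v du dv /(can_inj (@bwdK _ _ h)) /inj2; apply.
    + have -> : chi @` @open_disc R = h @^-1` (phi2 @` @open_disc R).
        apply/seteqP; split=> a /= [v ov va]; exists v => //.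
          by rewrite -va /chi bwdK.
        by rewrite /chi va fwdK.
      by apply: open_comp => // a _; exact: fwd_continuous.
  - by rewrite /chi Hc1.2 -Hp fwdK.
  - move=> v dv; rewrite /chi -(Hc3 v dv).2 -[phi2 v in RHS](@bwdK _ _ h) Hconj.
    by rewrite fwdK.
  - move=> v dv; rewrite -(Hc2.2 v dv) /pullback_leaf; congr connected_component.
    congr (_ `&` _); apply/seteqP; split=> w /=.
      by move=> lw; exists (chi w) => //; rewrite /chi bwdK.
    by move=> [a la aw]; rewrite /chi -aw fwdK.
(* Any point of the annulus would do: it yields a point of the surface to serve as the junk value of
   [embed]. *)
pose unit_point : 'rV[R]_2 := \row_i (if i == 0 then 1 else 0).
have a1 : annulus unit_point.
  rewrite /annulus /= leNgt enorm_lt ?enorm_le// !mxE /=.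
  by rewrite -leNgt; apply/andP; split; lra.
have P1 := annulus_outside Hphi1 a1.
pose s0 : bitorus phi1 phi2 :=
  bclass (exist _ (false, phi1 unit_point) (mem_set P1) : set_type (punctured phi1 phi2)).
pose i1 := embed s0 false; pose i2 a := embed s0 true (h a).
have out2 a : outside chi a -> punctured phi1 phi2 (true, h a).
  by move=> oa /hole2.
have ch v : h (chi v) = phi2 v by rewrite /chi bwdK.
have glue v : annulus v -> i1 (phi1 v) = i2 (chi (inversion v)).
  move=> av; rewrite /i1 /i2 ch; apply: embed_glue => //.
    exact: (annulus_outside Hphi1).
  exact: (annulus_outside Hphi2) (annulus_inversion av).
have glue' v : annulus v -> i2 (chi v) = i1 (phi1 (inversion v)).
  move=> av; rewrite glue; last exact: annulus_inversion.
  by rewrite inversionK//; exact: annulus_gt0.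
have glue_inv a b : outside phi1 a -> outside chi b -> i1 a = i2 b ->
    exists v, [/\ annulus v, a = phi1 v & b = chi (inversion v)].
  move=> oa ob /(embed_glue_inv Hphi1 Hphi2 oa (out2 _ ob))[v [av va vb]].
  by exists v; split=> //; rewrite /chi -vb fwdK.
have glue_inv' b a : outside chi b -> outside phi1 a -> i2 b = i1 a ->
    exists v, [/\ annulus v, b = chi v & a = phi1 (inversion v)].
  move=> ob oa /esym /(glue_inv _ _ oa ob)[v [av va vb]].
  exists (inversion v); split=> //; first exact: annulus_inversion.
  by rewrite inversionK//; exact: annulus_gt0.
have E1 : half_embedding f1 phi1 i1 f.
  split; first by move=> a V oa nV; exact: (@embed_continuous R phi1 phi2 s0 false a V oa nV).
    by move=> a b oa ob; exact: embed_inj.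
  move=> a oa; have [x xE iE] := embed_val s0 (oa : punctured phi1 phi2 (false, a)).
  have [y yE fE] := Hf.1 x a xE.
  by rewrite /i1 iE fE; exact: embedE.
(* On the second torus the glued map is conjugate to the inverse of [f1], so it is [bwd f] that acts
   as [f1]. *)
have E2 : half_embedding f1 chi i2 (bwd f).
  split.
  - move=> a V oa nV.
    have cb := @embed_continuous R phi1 phi2 s0 true (h a) V (out2 _ oa) nV.
    have cb' : nbhs a (h @^-1` [set b | punctured phi1 phi2 (true, b) ->
        V (embed s0 true b)]) by exact: (@fwd_continuous _ _ h a _ cb).
    by apply: filterS cb' => b bV ob; exact/bV/out2.
  - move=> a b oa ob /(embed_inj Hphi1 Hphi2 (out2 _ oa) (out2 _ ob)).
    exact: (can_inj (@fwdK _ _ h)).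
  move=> a oa; have ofa := outside_f (hc_f C2) oa.
  rewrite -[RHS](@fwdK _ _ f); congr (bwd f _).
  have [[v dv va]|nda] := pselect ((phi2 @` @disc R) (h (f1 a))); last first.
    have [x xE iE] := embed_val s0 (out2 _ ofa).
    have [y yE fE] := Hf.2 x _ xE nda.
    rewrite /i2 iE fE (embedE s0 yE); congr embed.
    by rewrite Hconj fwdK.
  (* The boundary circle of the disc is the only case left; it is glued to the
     boundary of the other hole, where the first clause applies. *)
  have vE : f1 a = chi v by rewrite /chi va fwdK.
  have aE : a = chi (4^-1 *: v) by rewrite -(hc_f C2)// -vE fwdK.
  have v2 : enorm v = 2.
    apply/eqP; rewrite eq_le dv /= leNgt; apply/negP => lt; apply: oa.
    exists (4^-1 *: v); first by rewrite /hole /= enorm_scale//; lra.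
    by rewrite aE.
  have av : annulus v by rewrite /annulus /= v2; apply/andP; split; lra.
  have av' := annulus_inversion av.
  have iv : enorm (inversion v) = 2^-1 by rewrite enorm_inversion v2.
  have a4 : annulus (4 *: inversion v).
    by rewrite /annulus /= enorm_scale// iv; apply/andP; split; lra.
  rewrite vE (glue' _ av) (he_comm E1); last exact: (annulus_outside Hphi1).
  rewrite (chart_quadruple C1); last exact: annulus_disc.
  rewrite (glue _ a4) inversionZ// inversionK ?annulus_gt0//.
  by rewrite -aE.
have gK : cancel f (bwd f) := @fwdK _ _ f.
have gbK : cancel (bwd f) f := @bwdK _ _ f.
have close_dyn a x y : dyn_ball d f a x y -> orbit_close d f (bwd f) a x y.
  move=> xy; split=> n; first exact: (xy (Posz n)).
  (* [Negz n] stands for [n.+1] backward steps, so backward index zero comes from [Posz 0]. *)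
  by case: n => [|n]; [exact: (xy (Posz 0))|exact: (xy (Negz n))].
split; last first.
  move=> [a a0 aP].
  have [c1 c10 c1P] := half_stable SL tF stab con (hc_chart C1) (hc_0 C1) (hc_f C1)
    (hc_leaf C1) Hd (he_cont E1) (he_comm E1) a0.
  have [c2 c20 c2P] := half_stable SL tF stab con (hc_chart C2) (hc_0 C2) (hc_f C2)
    (hc_leaf C2) Hd (he_cont E2) (he_comm E2) a0.
  (* The points will be [(1, t)] and [(1, t^-1)] with [t = 1 + tau]. The bound 1/4 keeps them in the
     annulus; the other two keep them within [c1], and their inversions within [c2], of each
     other. *)
  pose tau : R := Num.min 4^-1 (Num.min (c1 / 4) (c2 / 4)).
  have tau0 : 0 < tau by rewrite !lt_min !divr_gt0// andbT; lra.
  have tau4 : tau <= 4^-1 by rewrite ge_min lexx.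
  have tau1 : tau <= c1 / 4 by rewrite !ge_min lexx orbT.
  have tau2 : tau <= c2 / 4 by rewrite !ge_min lexx !orbT.
  pose t := 1 + tau; have t0 : 0 < t by rewrite /t; lra.
  pose pt (s : R) : 'rV[R]_2 := \row_i (if i == 0 then 1 else s).
  have ti : t^-1 = 1 - tau / t by rewrite /t; field; rewrite gt_eqF// -/t.
  have q0 : 0 < tau / t by rewrite divr_gt0.
  have q1 : tau / t <= tau by rewrite ler_pdivrMr// ler_peMr ?ltW// /t; lra.
  have ann s : 2^-1 <= s -> s <= 5 / 4 -> annulus (pt s).
    move=> s1 s2; rewrite /annulus /= leNgt enorm_lt ?enorm_le// !mxE /=.
    by rewrite -leNgt; apply/andP; split; nra.
  have at1 : annulus (pt t) by apply: ann; rewrite /t; lra.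
  have at2 : annulus (pt t^-1) by apply: ann; rewrite ti; lra.
  have sqE s : enorm (pt s) ^+ 2 = 1 + s ^+ 2.
    by rewrite /enorm sqr_sqrtr sum2E !mxE ?expr1n//= addr_ge0 ?sqr_ge0// ler01.
  have inv1 : inversion (pt t) = \row_i (if i == 0 then (1 + t ^+ 2)^-1 else t / (1 + t ^+ 2)).
    apply: rV2P; rewrite /inversion sqE !mxE /=; first by rewrite mulr1.
    by rewrite mulrC.
  have inv2 : inversion (pt t^-1) =
      \row_i (if i == 0 then t ^+ 2 / (1 + t ^+ 2) else t / (1 + t ^+ 2)).
    have n1 : 1 + t ^+ 2 != 0 by rewrite gt_eqF// ltr_pwDl ?sqr_ge0.
    apply: rV2P; rewrite /inversion sqE !mxE /=; field; rewrite n1 /= gt_eqF//=.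
  have row_norm (u w : 'rV[R]_2) c : 0 <= c -> `|u 0 0 - w 0 0| <= c ->
      `|u 0 1 - w 0 1| <= c -> `|u - w| <= c.
    move=> c0 h0 h1; apply: norm_le_coord => // j; rewrite !mxE.
    by have [->|->] : j = 0 \/ j = 1
      by case: j => [[|[|//]] ?]; [left|right]; exact/val_inj.
  have close1 : `|pt t^-1 - pt t| <= c1.
    apply: row_norm; rewrite ?mxE /= ?subrr ?normr0 ?ltW// ti ltr_norml /t.
    by apply/andP; split; lra.
  have close2 : `|inversion (pt t^-1) - inversion (pt t)| <= c2.
    rewrite inv1 inv2; apply: row_norm; rewrite ?mxE /= ?subrr ?normr0 ?ltW//.
    have D1 : 1 <= 1 + t ^+ 2 by rewrite lerDl sqr_ge0.
    have -> : t ^+ 2 / (1 + t ^+ 2) - (1 + t ^+ 2)^-1 = (t ^+ 2 - 1) / (1 + t ^+ 2).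
      by rewrite mulrBl mul1r.
    have tE : t ^+ 2 - 1 = 2 * tau + tau ^+ 2 by rewrite /t; ring.
    have tp : 0 <= t ^+ 2 - 1 by rewrite tE; nra.
    rewrite ger0_norm; last by rewrite divr_ge0//; lra.
    by rewrite ltr_pdivrMr; [rewrite tE; nra|lra].
  apply: (@card_gt1 _ (dyn_ball d f a (i1 (phi1 (pt t)))) (i1 (phi1 (pt t)))
    (i1 (phi1 (pt t^-1)))); last exact: aP.
  - move=> n; rewrite (distxx Hd) ltW//.
  (* Forward, the common abscissa puts both points on one leaf of the first chart; backward, their
     inversions share the ordinate [t / (1 + t ^+ 2)], hence a leaf of the second. *)
  - case=> n.
      by apply: c1P => //; rewrite !mxE.
    have av1 := annulus_inversion at1; have av2 := annulus_inversion at2.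
    rewrite /iterz (glue _ at1) (glue _ at2); apply: c2P => //.
    by rewrite inv1 inv2 !mxE.
  move=> /(he_inj E1 (annulus_outside Hphi1 at1) (annulus_outside Hphi1 at2)).
  have [_ inj1 _] := Hphi1.
  move=> /inj1; rewrite !inE => /(_ (annulus_disc at1) (annulus_disc at2)).
  by move=> /(congr1 (fun w : 'rV[R]_2 => w 0 1)); rewrite !mxE /= ti /t; lra.
have [e1 e10 e1P] := close_annulus SL tF stab C1 C2 Hd gK E1 E2 glue.
have [e2 e20 e2P] := close_annulus SL tF stab C2 C1 Hd gbK E2 E1 glue'.
have [e3 e30 e3P] := close_unreached SL tF con C1 C2 Hd gK E1 E2 glue glue_inv.
have [e4 e40 e4P] := close_unreached SL tF con C2 C1 Hd gbK E2 E1 glue' glue_inv'.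
pose a := Num.min (Num.min e1 e2) (Num.min e3 e4).
have a0 : 0 < a by rewrite !lt_min e10 e20 e30.
have close_le eps g gb x y : a <= eps -> orbit_close d g gb a x y -> orbit_close d g gb eps x y.
  by move=> le [c1 c2]; split=> n; [apply: le_trans (c1 n) le|apply: le_trans (c2 n) le].
have ae1 : a <= e1 by rewrite !ge_min lexx.
have ae2 : a <= e2 by rewrite !ge_min lexx !orbT.
have ae3 : a <= e3 by rewrite !ge_min lexx !orbT.
have ae4 : a <= e4 by rewrite !ge_min lexx !orbT.
have closeC eps x y : orbit_close d f (bwd f) eps x y -> orbit_close d (bwd f) f eps x y by case.
have cover y : (exists2 b, outside phi1 b & y = i1 b) \/ (exists2 b, outside chi b & y = i2 b).
  have [[] [b [Pb ->]]] := embed_surj s0 y; [right|left; by exists b].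
  exists (bwd h b); last by rewrite /i2 bwdK.
  by move=> /hole2; rewrite bwdK.
exists a => // x; suff [p [q pq]] : exists p q, forall y,
    orbit_close d f (bwd f) a x y -> y = p \/ y = q.
  by apply: (card_le_pair (p := p) (q := q)) => y /close_dyn; exact: pq.
have quad psi l w : half_chart f1 A p1 psi l -> annulus w ->
    f1 (psi (4^-1 *: w)) = psi w.
  move=> C aw; have := chart_quadruple C (u := 4^-1 *: w).
  by rewrite scalerKV//; apply; exact: annulus_disc.
(* The point with annular coordinate [u], read in the first torus for radius at least 1/2 and in the
   second otherwise. One step of [f1] from the quarter extends the charts to radii between 1/8 and
   8. *)
pose E (u : 'rV[R]_2) := if 2^-1 <= enorm u then i1 (f1 (phi1 (4^-1 *: u)))
  else i2 (f1 (chi (4^-1 *: inversion u))).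
(* Both candidates depend on [v] alone, as a bound on the number of such [y] requires. *)
have base v : annulus v -> forall y, orbit_close d f (bwd f) a (i1 (phi1 v)) y ->
    y = E v \/ y = E (\row_i (if i == 0 then v 0 0 else v 0 0 ^+ 2 / v 0 1)).
  move=> av y xy; have v0 := annulus_gt0 av; have av' := annulus_inversion av.
  suff [u [u0 uv0 uv1 ->]] : exists u, [/\ 0 < enorm u, u 0 0 = v 0 0,
      inversion u 0 1 = inversion v 0 1 & y = E u].
    by have [->|->] := vertical_circle u0 v0 uv0 uv1; [left|right].
  have [[b ob yb]|[b ob yb]] := cover y; subst y.
    have [u [/andP[u1 u2] uv0 uv1 bE]] := e1P v b av ob (close_le _ _ _ _ _ ae1 xy).
    exists u; split=> //; first by lra.
    by rewrite /E u1 bE.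
  rewrite (glue _ av) in xy.
  have [w [/andP[w1 w2] wv0 wv1 bE]] := e2P _ b av' ob (close_le _ _ _ _ _ ae2 (closeC _ _ _ xy)).
  have w0 : 0 < enorm w by lra.
  exists (inversion w); rewrite inversionK//; split=> //.
  - by rewrite enorm_inversion invr_gt0.
  - by rewrite wv1 inversionK.
  rewrite /E inversionK// enorm_inversion lef_pV2 ?posrE//.
  (* Here [y] comes from the second torus while [E] reads it in the first; on the annulus the two
     readings agree. *)
  case: ifPn => [w3|_]; last by rewrite bE.
  have aw : annulus w by apply/andP.
  have aw' := annulus_inversion aw.
  by rewrite bE (quad _ _ _ C2 aw) (quad _ _ _ C1 aw') glue'.
(* Closeness of full orbits is shift invariant, so it can be tested at the time when the orbit is in
   the annulus. *)
have shift g gb n x' y : cancel g gb -> cancel gb g ->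
    orbit_close d g gb a x' y -> orbit_close d g gb a (iter n gb x') (iter n gb y).
  move=> gK' gbK'; elim: n => // n IH /IH[c1 c2]; split=> m; last first.
    by rewrite -!iterSr; exact: c2.
  case: m => [|m]; first exact: (c2 1%N).
  have it z : iter m.+1 g (iter n.+1 gb z) = iter m g (iter n gb z).
    by rewrite [LHS]iterSr iterS gbK'.
  by rewrite !it; exact: c1.
(* An unreached point has no companion; any other point is moved into the annulus, and the two
   candidates found there are moved back. *)
have [[b ob ->]|[b ob ->]] := cover x.
  have [nb|rb] := pselect (unreached f1 phi1 b).
    by exists (i1 b), (i1 b) => y /(close_le _ _ _ _ _ ae3) by_; left; exact: (e3P _ _ nb by_ (cover y)).
  have [n [u [au ub]]] := reached_annulus (hc_f C1) ob rb.
  exists (iter n f (E u)), (iter n f (E (\row_i (if i == 0 then u 0 0 else u 0 0 ^+ 2 / u 0 1)))).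
  move=> y /(shift _ _ n _ _ gK gbK).
  rewrite (bwd_into_chi C1 gK E1 glue ub au ob) -(glue _ au) => /(base _ au).
  by move=> [yE|yE]; [left|right]; rewrite -yE (cancel_iter n gbK).
have [nb|rb] := pselect (unreached f1 chi b).
  exists (i2 b), (i2 b) => y /(close_le _ _ _ _ _ ae4) /closeC by_; left.
  by apply: (e4P _ _ nb by_); have [?|?] := cover y; [right|left].
have [n [u [au ub]]] := reached_annulus (hc_f C2) ob rb.
have au' := annulus_inversion au.
exists (iter n (bwd f) (E (inversion u))), (iter n (bwd f)
  (E (\row_i (if i == 0 then inversion u 0 0 else inversion u 0 0 ^+ 2 / inversion u 0 1)))).
move=> y /closeC /(shift _ _ n _ _ gbK gK).
rewrite (bwd_into_chi C2 gbK E2 glue' ub au ob) => -[c1 c2].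
have /(base _ au') : orbit_close d f (bwd f) a (i1 (phi1 (inversion u))) (iter n f y) by split.
by move=> [yE|yE]; [left|right]; rewrite -yE (cancel_iter n gK).
Qed.
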